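(* Let $(E,[\![\cdot,\cdot]\!],\rho)$ be a Lie algebroid over a manifold $Q$, $H:E^*\times\mathbb{R}\to\mathbb{R}$ a Hamiltonian function, and $\xi_H\in Sec(\mathcal{T}^E(E^*\times\mathbb{R}))$ the corresponding Hamiltonian section. Let $\gamma$ be a section of $\pi:E^*\times\mathbb{R}\to Q$ such that $j_\gamma:F_\gamma\to\mathcal{T}^E(E^*\times\mathbb{R})$, $i_\gamma:\gamma(Q)\to E^*\times\mathbb{R}$ is a Legendrian Lie subalgebroid of $\mathcal{T}^E(E^*\times\mathbb{R})$, and put $\xi_H^\gamma=pr_1\circ\xi_H\circ\gamma\in Sec(E)$. Then $\xi_H$ and $\xi_H^\gamma$ are $\gamma$-related, i.e. $$\xi_H\circ\gamma=(\mathrm{Id}_E,T\gamma\circ\rho)\circ\xi_H^\gamma,$$ if and only if $$H\circ\gamma=0 .$$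
   Context: All manifolds and maps are $C^\infty$; repeated indices are summed. Lie algebroids. A Lie algebroid $(E,[\![\cdot,\cdot]\!],\rho)$ over $Q$ is a vector bundle $\tau:E\to Q$ with a Lie bracket $[\![\cdot,\cdot]\!]$ on its sections $Sec(E)$ and a vector bundle map $\rho:E\to TQ$ (anchor) such that $[\![\sigma_1,f\sigma_2]\!]=f[\![\sigma_1,\sigma_2]\!]+(\rho(\sigma_1)f)\sigma_2$ for $f\in C^\infty(Q)$. In local coordinates $(q^i)$ on $Q$ and a local basis $\{e_\alpha\}$ of $Sec(E)$, the structure functions are defined by $\rho(e_\alpha)=\rho^i_\alpha\,\partial/\partial q^i$, $[\![e_\alpha,e_\beta]\!]=\mathcal{C}^\gamma_{\alpha\beta}e_\gamma$. The exterior differential $\mathrm{d}^E:Sec(\bigwedge^kE^* )\to Sec(\bigwedge^{k+1}E^* )$ is $\mathrm{d}^E\mu(\sigma_1,\dots,\sigma_{k+1})=\sum_i(-1)^{i+1}\rho(\sigma_i)\mu(\dots,\widehat{\sigma_i},\dots)+\sum_{i<j}(-1)^{i+j}\mu([\![\sigma_i,\sigma_j]\!],\dots,\widehat{\sigma_i},\dots,\widehat{\sigma_j},\dots)$. A vector bundle morphism $(F,f)$ between Lie algebroids $E\to Q$ and $E'\to Q'$ is a Lie algebroid morphism if $\mathrm{d}^E((F,f)^*\sigma')=(F,f)^*(\mathrm{d}^{E'}\sigma')$ for all $\sigma'\in Sec(\bigwedge^k(E')^* )$ and all $k$, where $((F,f)^*\sigma')_q(a_1,\dots,a_k)=\sigma'_{f(q)}(F(a_1),\dots,F(a_k))$.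 A Lie subalgebroid of $E\to M$ is a Lie algebroid morphism $j:F\to E$, $i:N\to M$ such that $(j,i)$ is a monomorphism of vector bundles and $i$ is an injective immersion. Contact Lie algebroids. A Lie algebroid $A\to M$ of rank $2k+1$ is contact if it has a section $\eta$ of $A^*$ with $\eta\wedge(\mathrm{d}^A\eta)^k\neq0$ everywhere; its Reeb section is the unique section $\mathcal{R}$ of $A$ with $\imath_{\mathcal{R}}\mathrm{d}^A\eta=0$, $\imath_{\mathcal{R}}\eta=1$. A Lie subalgebroid $j:F\to A$, $i:N\to M$ is Legendrian if $\dim F_x=k$ and $\eta(i(x))|_{j(F_x)}=0$ for all $x\in N$. Prolongation. Let $\pi:E^*\times\mathbb{R}\to Q$, $\pi(b^*_q,s)=q$. $\mathcal{T}^E(E^*\times\mathbb{R})\to E^*\times\mathbb{R}$ is the vector bundle with fibre over $(b^*_q,s)$ equal to $\{(a_q,v)\in E_q\times T_{(b^*_q,s)}(E^*\times\mathbb{R}):\rho(a_q)=T\pi(v)\}$; $pr_1(a_q,v)=a_q$. With coordinates $(q^i,y_\alpha,s)$ on $E^*\times\mathbb{R}$ induced by $(q^i)$ and the dual basis of $\{e_\alpha\}$, a local basis of sections is $\widetilde{\mathcal{X}}_\alpha=(e_\alpha,\rho^i_\alpha\,\partial/\partial q^i)$, $\widetilde{\mathcal{V}}_\alpha=(0,\partial/\partial y_\alpha)$, $\widetilde{\mathcal{V}}_s=(0,\partial/\partial s)$, with dual basis $\widetilde{\mathcal{X}}^\alpha,\widetilde{\mathcal{V}}^\alpha,\widetilde{\mathcal{V}}^s$.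 It is a Lie algebroid with anchor $\rho^{*\pi}(a_q,v)=v$ and bracket determined by $[\![\widetilde{\mathcal{X}}_\alpha,\widetilde{\mathcal{X}}_\beta]\!]^{*\pi}=\mathcal{C}^\gamma_{\alpha\beta}\widetilde{\mathcal{X}}_\gamma$, all other brackets of basis sections being zero. Let $\mathrm{d}$ be its exterior differential. It is a contact Lie algebroid with contact section $\eta=\widetilde{\mathcal{V}}^s-\Theta$, where $\widetilde{\mathcal{V}}^s=\mathrm{d}s$ and $\Theta_{(b^*_q,s)}(a_q,v)=b^*_q(a_q)$ (locally $\eta=\widetilde{\mathcal{V}}^s-y_\alpha\widetilde{\mathcal{X}}^\alpha$); its Reeb section is $\mathcal{R}=\widetilde{\mathcal{V}}_s$. The Hamiltonian section $\xi_H$ of $H$ is the unique section of $\mathcal{T}^E(E^*\times\mathbb{R})$ with $\imath_{\xi_H}\eta=-H$, $\imath_{\xi_H}\mathrm{d}\eta=\mathrm{d}H-\rho^{*\pi}(\mathcal{R})(H)\eta$; locally $\xi_H=\frac{\partial H}{\partial y_\alpha}\widetilde{\mathcal{X}}_\alpha-\big(\rho^i_\alpha\frac{\partial H}{\partial q^i}+\mathcal{C}^\gamma_{\alpha\beta}y_\gamma\frac{\partial H}{\partial y_\beta}+y_\alpha\frac{\partial H}{\partial s}\big)\widetilde{\mathcal{V}}_\alpha+\big(y_\alpha\frac{\partial H}{\partial y_\alpha}-H\big)\widetilde{\mathcal{V}}_s$. For a section $\gamma$ of $\pi$: $(\mathrm{Id}_E,T\gamma\circ\rho):E\to\mathcal{T}^E(E^*\times\mathbb{R})$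 is the map $a\mapsto(a,T\gamma(\rho(a)))$. $F_\gamma=\{(a,T\gamma(\rho(a))):a\in E\}$ is a vector bundle over $\gamma(Q)$, with the Lie algebroid structure transported from $E$ by the vector bundle isomorphism $((\mathrm{Id}_E,T\gamma\circ\rho),\gamma)$, and $j_\gamma:F_\gamma\to\mathcal{T}^E(E^*\times\mathbb{R})$, $i_\gamma:\gamma(Q)\to E^*\times\mathbb{R}$ are the inclusions. *)

(* Defs.v *)
From HB Require Import structures.
From mathcomp Require Import all_boot all_order all_algebra.
From mathcomp Require Import all_classical all_reals all_analysis.
Import Order.TTheory GRing.Theory Num.Theory numFieldNormedType.Exports.

Set Implicit Arguments.
Unset Strict Implicit.
Unset Printing Implicit Defensive.

Local Open Scope classical_set_scope.
Local Open Scope ring_scope.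

(* Structures are split into raw data (records [mfd], [vbundle], [algd]) and
   predicates stating the axioms ([is_manifold], [is_vbundle],
   [is_lie_algebroid]); the constructions below are then plain data.

   Carriers and fibres are subsets of ambient types.  Only the values on these
   subsets are meaningful; functions are total and arbitrary elsewhere. *)

(* f is of class C^m on the open set U: f is differentiable and all its
   directional derivatives x |-> 'd f x v are of class C^(m-1). *)
Fixpoint Cm (R : realType) (n : nat) (W : normedModType R) (m : nat)
    (U : set 'rV[R]_n) (f : 'rV[R]_n -> W) : Prop :=
  if m is m'.+1 then
    (forall x, U x -> differentiable f x) /\
    (forall v : 'rV[R]_n, Cm m' U (fun x => 'd f x v))
  else forall x, U x -> {for x, continuous f}.

Definition smooth_on (R : realType) (n : nat) (W : normedModType R)
    (U : set 'rV[R]_n) (f : 'rV[R]_n -> W) : Prop :=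
  forall m, Cm m U f.

(** * Manifolds *)

(* A set [car] with an atlas; the topology is the one induced by the atlas
   (see [mopen]).  [bwd i] is the inverse of the chart [fwd i : dom i -> R^n].
   [at_ x] is a chosen chart around x, used to represent tangent vectors. *)
Record mfd (R : realType) (n : nat) := Mfd {
  pt : Type;
  car : set pt;
  idx : Type;
  dom : idx -> set pt;
  fwd : idx -> pt -> 'rV[R]_n;
  bwd : idx -> 'rV[R]_n -> pt;
  at_ : pt -> idx
}.

Arguments car {R n} m.

Section Manifolds.
Context {R : realType} {n : nat}.
Variable M : mfd R n.

Definition mopen (W : set (pt M)) : Prop :=
  W `<=` car M /\ forall i : idx M, open (fwd i @` (dom i `&` W)).

Definition is_manifold : Prop :=
  (forall i : idx M, mopen (dom i)) /\
  (forall x : pt M, car M x -> dom (at_ x) x) /\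
  (forall (i : idx M) x, dom i x -> bwd i (fwd i x) = x) /\
  (forall i j : idx M,
     smooth_on (fwd i @` (dom i `&` dom j)) (fwd j \o bwd i)) /\
  (* Hausdorff *)
  (forall x y, car M x -> car M y -> x <> y ->
     exists V W, [/\ mopen V, mopen W, V x, W y & V `&` W = set0]) /\
  (* second countable *)
  (exists B : nat -> set (pt M), (forall l, mopen (B l)) /\
     forall W x, mopen W -> W x -> exists l, B l x /\ B l `<=` W).

Definition msmooth (W : normedModType R) (U : set (pt M)) (f : pt M -> W) :=
  forall i : idx M, smooth_on (fwd i @` (dom i `&` U)) (f \o bwd i).

(* The tangent space T_x M is 'rV_n: a tangent vector at x is represented by
   its components in the chart at_ x.  The components in another chart are
   obtained with [tcomp], and [tvec] is the inverse of [tcomp]. *)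
Definition tcomp (i : idx M) (x : pt M) (v : 'rV[R]_n) : 'rV[R]_n :=
  'd (fwd i \o bwd (at_ x)) (fwd (at_ x) x) v.

Definition tvec (i : idx M) (x : pt M) (w : 'rV[R]_n) : 'rV[R]_n :=
  'd (fwd (at_ x) \o bwd i) (fwd i x) w.

(* v(f), for v in T_x M *)
Definition der (x : pt M) (v : 'rV[R]_n) (f : pt M -> R) : R :=
  'd (f \o bwd (at_ x)) (fwd (at_ x) x) v.

End Manifolds.

Section Maps.
Context {R : realType} {m n : nat}.
Variables (M : mfd R m) (N : mfd R n) (f : pt M -> pt N).

Definition smooth_map : Prop :=
  (forall x, car M x -> car N (f x)) /\
  forall (i : idx M) (j : idx N),
    mopen (dom i `&` f @^-1` dom j) /\
    smooth_on (fwd i @` (dom i `&` f @^-1` dom j)) (fwd j \o f \o bwd i).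

(* T_x f : T_x M -> T_(f x) N *)
Definition tmap (x : pt M) (v : 'rV[R]_m) : 'rV[R]_n :=
  'd (fwd (at_ (f x)) \o f \o bwd (at_ x)) (fwd (at_ x) x) v.

Definition injective_immersion : Prop :=
  smooth_map /\
  (forall x y, car M x -> car M y -> f x = f y -> x = y) /\
  (forall x, car M x -> injective (tmap x)).

End Maps.

(** * Vector bundles *)

(* The fibre over x is the subspace [fmem x] of the module [fib x].
   [tcrd t x] are the linear coordinates on the fibre over x given by the
   trivialization t over the open set [tdom t], [tinv t x] is its inverse, so
   that x |-> tinv t x (delta_mx 0 a) is the a-th section of a local basis.
   [tat x] is a trivialization around x. *)
Record vbundle (R : realType) (n : nat) (M : mfd R n) (r : nat) := VBundle {
  fib : pt M -> lmodType R;
  fmem : forall x, set (fib x);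
  tidx : Type;
  tdom : tidx -> set (pt M);
  tcrd : tidx -> forall x, fib x -> 'rV[R]_r;
  tinv : tidx -> forall x, 'rV[R]_r -> fib x;
  tat : pt M -> tidx
}.

Arguments fib {R n M r} v.
Arguments tat {R n M r} v.

Section Bundles.
Context {R : realType} {n r : nat} {M : mfd R n}.
Variable E : vbundle M r.

Definition is_vbundle : Prop :=
  (forall x, car M x -> fmem (0 : fib E x) /\
     forall (a : R) (u v : fib E x), fmem u -> fmem v -> fmem (a *: u + v)) /\
  (forall t : tidx E, mopen (tdom t)) /\
  (forall x, car M x -> tdom (tat E x) x) /\
  (forall (t : tidx E) x, tdom t x ->
     [/\ forall v, fmem (tinv t x v),
         forall (a : R) v w, tinv t x (a *: v + w) = a *: tinv t x v + tinv t x w,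
         cancel (tinv t x) (tcrd t (x := x)) &
         forall u : fib E x, fmem u -> tinv t x (tcrd t u) = u]) /\
  (forall (t t' : tidx E) v,
     msmooth (tdom t `&` tdom t') (fun x => tcrd t' (tinv t x v))).

Definition sect := forall x : pt M, fib E x.

Definition smooth_sect (s : sect) : Prop :=
  (forall x, car M x -> fmem (s x)) /\
  (forall t : tidx E, msmooth (tdom t) (fun x => tcrd t (s x))).

Definition eq_near (x : pt M) (s s' : sect) : Prop :=
  exists W : set (pt M), [/\ mopen W, W x & forall y, W y -> s y = s' y].

(* A k-form is a section of the k-th exterior power of the dual of E; its value
   at x takes lists of k vectors in the fibre over x. *)
Definition form := forall x : pt M, seq (fib E x) -> R.

Definition is_form (k : nat) (mu : form) : Prop :=
  (forall x (s1 s2 : seq (fib E x)) (a : R) (u v : fib E x),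
     car M x -> (size s1 + size s2).+1 = k ->
     (forall w, w \in s1 ++ u :: v :: s2 -> fmem w) ->
     mu x (s1 ++ (a *: u + v) :: s2) =
       a * mu x (s1 ++ u :: s2) + mu x (s1 ++ v :: s2)) /\
  (forall x (s1 s2 s3 : seq (fib E x)) (u : fib E x),
     car M x -> (size s1 + size s2 + size s3).+2 = k ->
     (forall w, w \in s1 ++ u :: s2 ++ s3 -> fmem w) ->
     mu x (s1 ++ u :: s2 ++ u :: s3) = 0) /\
  (forall (t : tidx E) (vs : seq 'rV[R]_r), size vs = k ->
     msmooth (tdom t) (fun x => mu x [seq tinv t x v | v <- vs])).

End Bundles.

Arguments sect {R n r M} E.
Arguments form {R n r M} E.

Definition tangent_bundle (R : realType) (n : nat) (M : mfd R n) : vbundle M n :=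
  @VBundle R n M n (fun=> 'rV[R]_n) (fun=> setT) (idx M) (@dom R n M)
    (@tcomp R n M) (@tvec R n M) (@at_ R n M).

(* (F, f) is a morphism of vector bundles *)
Definition vb_morphism (R : realType) (m n r r' : nat)
    (M : mfd R m) (N : mfd R n) (E : vbundle M r) (E' : vbundle N r')
    (f : pt M -> pt N) (F : forall x, fib E x -> fib E' (f x)) : Prop :=
  smooth_map f /\
  (forall x (u : fib E x), car M x -> fmem u -> fmem (F x u)) /\
  (forall x (a : R) (u v : fib E x), car M x -> fmem u -> fmem v ->
     F x (a *: u + v) = a *: F x u + F x v) /\
  (forall (t : tidx E) (t' : tidx E') v,
     msmooth (tdom t `&` f @^-1` tdom t')
       (fun x => tcrd t' (F x (tinv t x v)))).

Definition pullback (R : realType) (m n r r' : nat)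
    (M : mfd R m) (N : mfd R n) (E : vbundle M r) (E' : vbundle N r')
    (f : pt M -> pt N) (F : forall x, fib E x -> fib E' (f x))
    (mu : form E') : form E :=
  fun x l => mu (f x) [seq F x u | u <- l].

(** * Lie algebroids *)

Record algd (R : realType) (n : nat) (M : mfd R n) (r : nat) := Algd {
  vb :> vbundle M r;
  anchor : forall x, fib vb x -> 'rV[R]_n;
  bracket : sect vb -> sect vb -> sect vb
}.

Section Algebroids.
Context {R : realType} {n r : nat} {M : mfd R n}.
Variable E : algd M r.

Definition is_lie_algebroid : Prop :=
  is_manifold M /\
  is_vbundle E /\
  @vb_morphism R n n r n M M E (tangent_bundle M) id (@anchor R n M r E) /\
  (forall s s' : sect E, smooth_sect s -> smooth_sect s' ->
     smooth_sect (bracket s s')) /\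
  (* bilinear (with the antisymmetry that follows) *)
  (forall (a : R) (s1 s2 s : sect E) x,
     smooth_sect s1 -> smooth_sect s2 -> smooth_sect s -> car M x ->
     bracket (fun y => a *: s1 y + s2 y) s x =
       a *: bracket s1 s x + bracket s2 s x) /\
  (forall (s s' : sect E) x, smooth_sect s -> smooth_sect s' -> car M x ->
     bracket s s' x = - bracket s' s x) /\
  (* Jacobi identity *)
  (forall (s1 s2 s3 : sect E) x,
     smooth_sect s1 -> smooth_sect s2 -> smooth_sect s3 -> car M x ->
     bracket s1 (bracket s2 s3) x + bracket s2 (bracket s3 s1) x +
       bracket s3 (bracket s1 s2) x = 0) /\
  (* Leibniz rule *)
  (forall (f : pt M -> R) (s1 s2 : sect E) x,
     msmooth (car M) f -> smooth_sect s1 -> smooth_sect s2 -> car M x ->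
     bracket s1 (fun y => f y *: s2 y) x =
       f x *: bracket s1 s2 x + der x (anchor (s1 x)) f *: s2 x).

(* (d mu)(s_0, ..., s_k) for the list of sections ss = [:: s_0; ...; s_k].
   The signs are those of the usual formula, the indices starting from 0. *)
Definition ext_diff (mu : form E) (ss : seq (sect E)) (x : pt M) : R :=
  let s i := nth (fun y => 0) ss i in
  \sum_(i < size ss) (-1) ^+ i *
     der x (anchor (s i x))
       (fun y => mu y [seq s' y | s' <- take i ss ++ drop i.+1 ss]) +
  \sum_(i < size ss) \sum_(j < size ss | (i < j)%N) (-1) ^+ (i + j) *
     mu x (bracket (s i) (s j) x ::
       [seq s' x | s' <- take i ss ++ drop i.+1 (take j ss) ++ drop j.+1 ss]).

(* nu = d mu for a k-form mu: d mu is determined pointwise by its values on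
   sections. *)
Definition is_ext_diff (k : nat) (mu nu : form E) : Prop :=
  forall (ss : seq (sect E)) x, size ss = k.+1 ->
    (forall i, (i < k.+1)%N -> smooth_sect (nth (fun y => 0) ss i)) ->
    car M x ->
    nu x [seq s x | s <- ss] = ext_diff mu ss x.

(* A function as a 0-form *)
Definition form0 (f : pt M -> R) : form E := fun x _ => f x.

(* The Reeb section of the contact section eta *)
Definition is_reeb (eta : form E) (Rb : sect E) : Prop :=
  smooth_sect Rb /\
  (forall s x, smooth_sect s -> car M x -> ext_diff eta [:: Rb; s] x = 0) /\
  (forall x, car M x -> eta x [:: Rb x] = 1).

(* The Hamiltonian section of H, for the contact section eta with Reeb
   section Rb *)
Definition is_hamiltonian_section (eta : form E) (Rb : sect E)
    (H : pt M -> R) (xi : sect E) : Prop :=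
  smooth_sect xi /\
  (forall x, car M x -> eta x [:: xi x] = - H x) /\
  (forall s x, smooth_sect s -> car M x ->
     ext_diff eta [:: xi; s] x =
       ext_diff (form0 H) [:: s] x - der x (anchor (Rb x)) H * eta x [:: s x]).

End Algebroids.

Section Subalgebroids.
Context {R : realType} {m n r r' : nat} {N : mfd R m} {M : mfd R n}.
Variables (F : algd N r) (A : algd M r').
Variables (i : pt N -> pt M) (j : forall x, fib F x -> fib A (i x)).

Definition lie_algebroid_morphism : Prop :=
  vb_morphism j /\
  forall k (mu dmu : form A), is_form k mu -> is_ext_diff k mu dmu ->
    is_ext_diff k (pullback j mu) (pullback j dmu).

Definition lie_subalgebroid : Prop :=
  is_lie_algebroid F /\
  lie_algebroid_morphism /\
  (forall x (u v : fib F x), car N x -> fmem u -> fmem v ->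
     j u = j v -> u = v) /\
  injective_immersion i.

(* The ambient contact Lie algebroid has rank 2k+1, where k is the rank of the
   Legendrian Lie subalgebroid. *)
Definition legendrian (eta : form A) : Prop :=
  lie_subalgebroid /\
  r' = r.*2.+1 /\
  (forall x (u : fib F x), car N x -> fmem u -> eta (i x) [:: j u] = 0).

End Subalgebroids.

(** * The manifold E^* x R and the prolongation of E *)

Section Prolongation.
Context {R : realType} {n k : nat} {Q : mfd R n}.
Variable E : algd Q k.

(* The dual of the fibre E_q: linear functions on fmem q, extended by 0. *)
Definition dual (q : pt Q) : set (fib E q -> R) :=
  [set b | (forall (a : R) (u v : fib E q), fmem u -> fmem v ->
              b (a *: u + v) = a * b u + b v) /\
  (forall u, ~ fmem u -> b u = 0)].

Definition phase_pt := {q : pt Q & ((fib E q -> R) * R)%type}.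

Definition phase_car : set phase_pt :=
  [set p | car Q (projT1 p) /\ dual (projT2 p).1].

(* Coordinates (q^i, y_a, s) induced by a chart c.1 of Q and the dual of the
   local basis of E given by a trivialization c.2 *)
Definition phase_fwd (c : idx Q * tidx E) (p : phase_pt) : 'rV[R]_(n + k + 1) :=
  row_mx
    (row_mx (fwd c.1 (projT1 p))
            (\row_a (projT2 p).1 (tinv c.2 (projT1 p) (delta_mx 0 a))))
    (const_mx (projT2 p).2).

Definition phase_bwd (c : idx Q * tidx E) (z : 'rV[R]_(n + k + 1)) : phase_pt :=
  let q := bwd c.1 (lsubmx (lsubmx z)) in
  existT _ q
    (fun u : fib E q =>
       if `[< fmem u >] then \sum_a rsubmx (lsubmx z) 0 a * tcrd c.2 u 0 a
       else 0,
     rsubmx z 0 0).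

Definition phase : mfd R (n + k + 1) :=
  @Mfd R (n + k + 1) phase_pt phase_car (idx Q * tidx E)%type
    (fun c => [set p | [/\ phase_car p, dom c.1 (projT1 p) &
                           tdom c.2 (projT1 p)]])
    phase_fwd phase_bwd
    (fun p => (at_ (projT1 p), tat E (projT1 p))).

Definition proj_pi : pt phase -> pt Q := fun p => projT1 p.

Definition prol_fib (p : pt phase) : lmodType R :=
  (fib E (proj_pi p) * 'rV[R]_(n + k + 1))%type.

(* The element of the prolongation with coordinates (z^a, z_a, z_s) in the
   local basis X_a, V_a, V_s *)
Definition prol_tinv (c : idx phase) (p : pt phase)
    (z : 'rV[R]_(k + (k + 1))) : prol_fib p :=
  let a := tinv c.2 (proj_pi p) (lsubmx z) in
  (a, tvec c p (row_mx (row_mx (tcomp c.1 (proj_pi p) (anchor a))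
                               (lsubmx (rsubmx z)))
                       (rsubmx (rsubmx z)))).

Definition prol_tcrd (c : idx phase) (p : pt phase) (w : prol_fib p) :
    'rV[R]_(k + (k + 1)) :=
  let v := tcomp c p w.2 in
  row_mx (tcrd c.2 w.1) (row_mx (rsubmx (lsubmx v)) (rsubmx v)).

Definition prol_vb : vbundle phase (k + (k + 1)) :=
  @VBundle R (n + k + 1) phase (k + (k + 1)) prol_fib
    (fun p => [set w : prol_fib p | fmem w.1 /\
  anchor w.1 = tmap (N := Q) proj_pi p w.2])
    (idx phase) (@dom R _ phase) prol_tcrd prol_tinv (@at_ R _ phase).

Definition prol_basis (c : idx phase) (l : 'I_(k + (k + 1))) : sect prol_vb :=
  fun p => prol_tinv c p (delta_mx 0 l).

(* The prolongation with the bracket br *)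
Definition prolongation (br : sect prol_vb -> sect prol_vb -> sect prol_vb) :
    algd phase (k + (k + 1)) :=
  @Algd R _ phase _ prol_vb (fun p (w : prol_fib p) => w.2) br.

(* The bracket on global sections, as given on local bases: the values at p are
   prescribed for sections which agree near p with sections of the local basis.
   The coefficients in the first clause are the structure functions of E. *)
Definition is_prolongation_bracket
    (br : sect prol_vb -> sect prol_vb -> sect prol_vb) : Prop :=
  is_lie_algebroid (prolongation br) /\
  forall (c : idx phase) (p : pt phase) (S T : sect prol_vb),
    dom c p -> smooth_sect S -> smooth_sect T ->
    (forall (a b : 'I_k) (sa sb : sect E),
       smooth_sect sa -> smooth_sect sb ->
       eq_near (proj_pi p) sa (fun q => tinv c.2 q (delta_mx 0 a)) ->
       eq_near (proj_pi p) sb (fun q => tinv c.2 q (delta_mx 0 b)) ->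
       eq_near p S (prol_basis c (lshift (k + 1) a)) ->
       eq_near p T (prol_basis c (lshift (k + 1) b)) ->
       br S T p =
         \sum_(g < k) tcrd c.2 (bracket sa sb (proj_pi p)) 0 g *:
           prol_basis c (lshift (k + 1) g) p) /\
  (forall l m : 'I_(k + (k + 1)), (k <= l)%N || (k <= m)%N ->
       eq_near p S (prol_basis c l) -> eq_near p T (prol_basis c m) ->
       br S T p = 0).

(* eta = ds - Theta *)
Definition contact_form : form prol_vb :=
  fun p l =>
    if l is [:: w] then
      der p w.2 (fun p' : pt phase => (projT2 p').2) - (projT2 p).1 w.1
    else 0.

(** * The Lie algebroid F_gamma *)

Section Gamma.
Variable gamma : forall q : pt Q, ((fib E q -> R) * R)%type.

Definition sec_map (q : pt Q) : pt phase := existT _ q (gamma q).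

(* (Id_E, T gamma o rho) *)
Definition gamma_lift (q : pt Q) (a : fib E q) : prol_fib (sec_map q) :=
  (a, tmap (M := Q) (N := phase) sec_map q (anchor a)).

(* gamma(Q), with the charts of Q transported by gamma *)
Definition gamma_car : set phase_pt := [set sec_map q | q in car Q].

Definition gamma_image : mfd R n :=
  @Mfd R n phase_pt gamma_car (idx Q)
    (fun i => [set p | gamma_car p /\ dom i (projT1 p)])
    (fun i p => fwd i (projT1 p))
    (fun i z => sec_map (bwd i z))
    (fun p => at_ (projT1 p)).

(* For p in gamma(Q) one has sec_map (proj_pi p) = p, so that the fibre of
   F_gamma over p is the set of all gamma_lift a with a in E_(proj_pi p); the
   tangent component of gamma_lift a does not depend on p as a row vector. *)
Definition F_lift (p : phase_pt) (a : fib E (projT1 p)) : prol_fib p :=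
  (a, (gamma_lift a).2).

Definition F_vb : vbundle gamma_image k :=
  @VBundle R n gamma_image k prol_fib
    (fun p => [set F_lift a | a in @fmem _ _ _ _ E (projT1 p)])
    (tidx E)
    (fun t => [set p | gamma_car p /\ tdom t (projT1 p)])
    (fun t p w => tcrd t w.1)
    (fun t p z => F_lift (tinv t (projT1 p) z))
    (fun p => tat E (projT1 p)).

(* Anchor and bracket transported from E.  The tangent vectors of gamma_image
   are represented in the transported charts, so T gamma : TQ -> T(gamma(Q))
   is the identity on components. *)
Definition F_gamma : algd gamma_image k :=
  @Algd R n gamma_image k F_vb
    (fun p (w : prol_fib p) => anchor w.1)
    (fun S T p =>
       F_lift (bracket (fun q => (S (sec_map q)).1 : fib E q)
                       (fun q => (T (sec_map q)).1 : fib E q) (projT1 p))).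

Definition i_gamma : pt gamma_image -> pt phase := id.

Definition j_gamma : forall p, fib F_gamma p -> fib prol_vb (i_gamma p) :=
  fun p => id.

(* xi^gamma = pr_1 o xi o gamma *)
Definition xi_gamma (xi : sect prol_vb) : sect E := fun q => (xi (sec_map q)).1.

Definition gamma_related (xi : sect prol_vb) (s : sect E) : Prop :=
  forall q, car Q q -> xi (sec_map q) = gamma_lift (s q).

End Gamma.

End Prolongation.

(* Main.v *)
Require Import Defs.
From HB Require Import structures.
From mathcomp Require Import all_boot all_order all_algebra.
From mathcomp Require Import all_classical all_reals all_analysis.
From mathcomp Require Import ring lra.
Import Order.TTheory GRing.Theory Num.Theory numFieldNormedType.Exports.

(** Write p = gamma(q) and let w be the lift to F_gamma of the E-component of
    xi(p), so that gamma-relatedness says xi(p) = w for every q.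

    If xi(p) = w then -H(p) = eta(xi(p)) = eta(w) = 0, because eta vanishes on the
    Legendrian subalgebroid F_gamma.

    Conversely, let H vanish on gamma(Q).  The difference D = xi(p) - w has no
    component in E, and eta(D) = -H(p) - 0 = 0.  It is also d eta-orthogonal to
    F_gamma.  Indeed d eta(w, .) = 0 on F_gamma since the pullback of eta to
    F_gamma is 0 and the inclusion is a Lie algebroid morphism
    ([ext_diff_isotropic]); and for v in F_gamma the Hamiltonian equation gives
    d eta(xi(p), v) = dH(v) - R(H) eta(v) = dH(v), which is 0 because the anchor
    of v is tangent to gamma(Q), where H is constant ([der_tmap]).  In the
    classical proof F_gamma is a Lagrangian subspace of ker eta, so D lies in it
    and then D = 0.  Here this linear algebra is replaced by a direct
    computation in the basis X_a, V_a, V_s: D is a combination z^a V_a, and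
    d eta(V_a, .) = -X^a ([ext_diff_frame]), so that pairing D with the lifts of
    a basis of E shows that all the z^a are 0
    ([vertical_deta_orthogonal_eq0]).

    The differential is given on global sections only, whereas the argument is
    about vectors at a single point.  The passage from one to the other is the
    tensoriality of d eta ([ext_diff_tensorial]) and the existence of global
    sections extending a local basis ([local_frame]).  Both rest on smooth bump
    functions on a Hausdorff manifold ([mfd_bump]), which are built from
    exp(-1/t). *)

Set Implicit Arguments.
Unset Strict Implicit.
Unset Printing Implicit Defensive.

Local Open Scope classical_set_scope.
Local Open Scope ring_scope.

(** * Calculus of functions of class C^m *)

(** Differentiability and the differential are local; this is what allows
    two functions that agree only on a chart domain to be exchanged below a
    differential. *)
Lemma near_eq_diff (R : realType) (V W : normedModType R) (f g : V -> W) (x : V) :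
  (\forall y \near x, f y = g y) -> differentiable f x ->
  differentiable g x /\ 'd g x = 'd f x :> (V -> W).
Proof.
move=> fg df.
have [cf /eqaddoP Df] := (diff_locallyP x f).1 df.
have gx : g x = f x by rewrite (nbhs_singleton fg).
have Dg : g \o shift x = cst (g x) + 'd f x +o_ 0 id.
  apply/eqaddoP => e e0; have := Df e e0.
  have : \forall h \near 0, f (h + x) = g (h + x).
    have c : (fun h => h + x) @ (0 : V) --> x.
      by rewrite -[X in _ --> X]add0r; apply: cvgD; [exact: cvg_id|exact: cvg_cst].
    exact: (c _ fg).
  move=> fg0 Dfe; near=> h.
  have -> : (g \o shift x - (cst (g x) + 'd f x)) h =
            (f \o shift x - (cst (f x) + 'd f x)) h.
    rewrite /= !fctE /= gx; congr (_ - _).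
    by apply/esym; near: h.
  by near: h.
have E : 'd g x = 'd f x :> (V -> W) by exact: diff_unique cf Dg.
split; last exact: E.
by apply/diff_locallyP; rewrite E; split; [exact: cf|exact: Dg].
Unshelve. all: by end_near. Qed.

Section Cm_calculus.
Context {R : realType} {n : nat}.
Implicit Types (U V : set 'rV[R]_n).

Lemma open_near U x : open U -> U x -> \forall y \near x, U y.
Proof. by move=> oU Ux; exact: open_nbhs_nbhs. Qed.

Lemma Cm_sub (W : normedModType R) m U V (f : 'rV[R]_n -> W) :
  V `<=` U -> Cm m U f -> Cm m V f.
Proof.
move=> VU; elim: m f => [|m IH] f /=; first by move=> h x /VU /h.
by move=> [h1 h2]; split => [x /VU /h1 //|v]; exact: IH.
Qed.

(** The predicate Cm only refers to the points of U, so that being of class C^m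
    can be checked around each point; every patching argument on a manifold
    rests on this. *)
Lemma Cm_glue (W : normedModType R) m U (f : 'rV[R]_n -> W) :
  (forall x, U x -> exists2 V, V x & Cm m V f) -> Cm m U f.
Proof.
elim: m f => [|m IH] f /= h; first by move=> x /h[V Vx]; apply.
split=> [x /h[V Vx [d _]]|v]; first exact: d.
by apply: IH => x /h[V Vx [_ +]]; exists V.
Qed.

(** Openness of U is essential here and in the closure properties below: the
    differential at a point of U depends on nearby values, and the induction on
    m compares the differentials of f and g on all of U. *)
Lemma Cm_ext (W : normedModType R) m U (f g : 'rV[R]_n -> W) : open U ->
  (forall x, U x -> f x = g x) -> Cm m U f -> Cm m U g.
Proof.
move=> oU; elim: m f g => [|m IH] f g fg /=;
  (have fgn x : U x -> \forall y \near x, f y = g y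
     by move=> Ux; near=> y; apply: fg; near: y; exact: open_near).
  move=> h x Ux; rewrite /prop_for /continuous_at -fg //.
  apply: cvg_trans (h x Ux).
  exact: near_eq_cvg (fgn x Ux).
move=> [h1 h2].
have E x : U x -> differentiable g x /\ 'd g x = 'd f x :> (_ -> _).
  move=> Ux; apply: near_eq_diff (h1 _ Ux).
  exact: fgn.
split=> [x /E[d _]|v]; first exact: d.
by apply: IH (h2 v) => x /E[_ /(congr1 (@^~ v)) e]; exact: esym e.
Unshelve. all: by end_near. Qed.

Lemma smooth_diff (W : normedModType R) U (f : 'rV[R]_n -> W) x :
  smooth_on U f -> U x -> differentiable f x.
Proof. by move=> /(_ 1%N)[h _]; exact: h. Qed.

Lemma Cm_cst (W : normedModType R) m U (w : W) : Cm m U (fun=> w).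
Proof.
elim: m w => [|m IH] w /=; first by move=> x _; exact: (@cst_continuous _ _ w x).
split=> [x _|v]; first exact: differentiable_cst.
suff -> : (fun x : 'rV[R]_n => 'd (fun=> w) x v) = fun=> 0 by exact: IH.
by apply/funext => x; have -> := diff_cst w x.
Qed.

Lemma CmD (W : normedModType R) m U (f g : 'rV[R]_n -> W) : open U ->
  Cm m U f -> Cm m U g -> Cm m U (fun x => f x + g x).
Proof.
move=> oU; elim: m f g => [|m IH] f g /=.
  by move=> hf hg x Ux; exact: cvgD (hf x Ux) (hg x Ux).
move=> [f1 f2] [g1 g2]; split=> [x Ux|v].
  by apply: differentiableD; [exact: f1|exact: g1].
apply: (Cm_ext oU _ (IH _ _ (f2 v) (g2 v))) => x Ux.
exact: esym (congr1 (@^~ v) (diffD (f1 _ Ux) (g1 _ Ux))).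
Qed.

Lemma Cm_linear (W W' : normedModType R) m U (L : {linear W -> W'})
    (f : 'rV[R]_n -> W) : open U -> continuous L ->
  Cm m U f -> Cm m U (fun x => L (f x)).
Proof.
move=> oU cL; elim: m f => [|m IH] f /=.
  by move=> hf x Ux; apply: continuous_comp; [exact: hf|exact: cL].
move=> [f1 f2]; split=> [x Ux|v].
  apply: differentiable_comp; [exact: f1|exact: linear_differentiable].
apply: (Cm_ext oU _ (IH _ (f2 v))) => x Ux.
have /= -> := diff_comp (f1 _ Ux) (linear_differentiable (f x) cL).
by rewrite /= diff_lin.
Qed.

Lemma CmW (W : normedModType R) m U (f : 'rV[R]_n -> W) :
  Cm m.+1 U f -> Cm m U f.
Proof.
elim: m f => [|m IH] f /=.
  by move=> [f1 _] x /f1 /differentiable_continuous.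
by move=> [f1 f2]; split => // v; exact: IH.
Qed.

(** The Leibniz rule for a scalar times a vector, obtained from the
    differential of the continuous bilinear map (a, w) |-> a *: w. *)
Lemma diff_scale (W : normedModType R) (f : 'rV[R]_n -> R) (g : 'rV[R]_n -> W) x :
  differentiable f x -> differentiable g x ->
  is_diff x (fun y => f y *: g y) (fun v => f x *: 'd g x v + 'd f x v *: g x).
Proof.
move=> df dg.
have sb : bilinear_for (GRing.Scale.Law.clone _ _ *:%R _)
    (GRing.Scale.Law.clone _ _ *:%R _) (fun (a : R) (w : W) => a *: w).
  by split=> [w|a] b u v /=; rewrite ?scalerDl ?scalerDr !scalerA // mulrC.
pose bM := bilinear_isBilinear.Build R R W W _ _ (fun (a : R) (w : W) => a *: w) sb.
pose b : {bilinear R -> W -> W} := HB.pack (fun (a : R) (w : W) => a *: w) bM.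
have cb : continuous (fun p : R * W => b p.1 p.2).
  by move=> p; exact: scale_continuous.
have dp := differentiable_pair df dg.
have db := differentiable_bilin (f := b) (f x, g x) cb.
apply: DiffDef; first exact: (differentiable_comp dp db).
apply/funext => v; have /= -> := diff_comp dp db.
by rewrite /= (diff_bilin _ cb) diff_pair.
Qed.

Lemma CmZ (W : normedModType R) m U (f : 'rV[R]_n -> R) (g : 'rV[R]_n -> W) :
  open U -> Cm m U f -> Cm m U g -> Cm m U (fun x => f x *: g x).
Proof.
move=> oU.
elim: m f g => [|m IH] f g.
  by move=> hf hg x Ux; exact: cvgZ (hf x Ux) (hg x Ux).
move=> hf hg; have := (CmW hf, CmW hg) => -[f0 g0].
case: hf hg => [f1 f2] [g1 g2]; split=> [x Ux|v].
  by have [] := diff_scale (f1 _ Ux) (g1 _ Ux).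
apply: (Cm_ext oU _ (CmD oU (IH _ _ f0 (g2 v)) (IH _ _ (f2 v) g0))) => x Ux.
by have [_ /(congr1 (@^~ v)) e] := diff_scale (f1 _ Ux) (g1 _ Ux); exact: esym e.
Qed.

Lemma Cm_sum (W : normedModType R) m U (I : Type) (r : seq I)
    (f : I -> 'rV[R]_n -> W) : open U ->
  (forall i, Cm m U (f i)) -> Cm m U (fun x => \sum_(i <- r) f i x).
Proof.
move=> oU h; elim: r => [|i r IH].
  by apply: Cm_ext (Cm_cst m U 0) => // x _; rewrite big_nil.
by apply: Cm_ext (CmD oU (h i) IH) => // x _; rewrite big_cons.
Qed.

End Cm_calculus.

Section entry.
Context {R : realType} {n : nat} (i : 'I_n).
Definition entry (v : 'rV[R]_n) : R := v 0 i.
Fact entry_linear : linear entry.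
Proof. by move=> a u v; rewrite /entry !mxE. Qed.
HB.instance Definition _ := GRing.isLinear.Build R 'rV[R]_n R _ entry entry_linear.
Lemma entry_cont : continuous entry.
Proof. move=> v; exact: coord_continuous. Qed.
End entry.

Section Cm_comp.
Context {R : realType} {n p : nat}.

(** By the chain rule 'd (f \o g) x v is the sum of the products of the i-th entry
    of 'd g x v, smooth in x, with 'd f (g x) e_i, which is a partial derivative
    of f composed with g: this has one derivative less, hence the induction on m
    for all f at once. *)
Lemma Cm_comp (W : normedModType R) m (U : set 'rV[R]_n) (V : set 'rV[R]_p)
    (g : 'rV[R]_n -> 'rV[R]_p) (f : 'rV[R]_p -> W) : open U ->
  (forall x, U x -> V (g x)) -> smooth_on U g -> Cm m V f -> Cm m U (f \o g).
Proof.
move=> oU gV sg; elim: m f => [|m IH] f.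
  move=> hf x Ux; apply: continuous_comp; last exact: hf (gV _ Ux).
  exact: sg 0%N _ Ux.
move=> [f1 f2]; split=> [x Ux|v].
  by apply: differentiable_comp (f1 _ (gV _ Ux)); exact: smooth_diff sg Ux.
apply: (Cm_ext (f := fun x => \sum_i ('d g x v) 0 i *: ('d f (g x) (delta_mx 0 i)))
    oU).
  move=> x Ux.
  have /= -> := diff_comp (smooth_diff sg Ux) (f1 _ (gV _ Ux)).
  rewrite /= [X in _ = 'd f _ X](row_sum_delta) linear_sum /=.
  by apply: eq_bigr => i _; rewrite linearZ.
apply: Cm_sum => // i; apply: CmZ => //; last exact: IH (f2 _).
have [_ /(_ v) h] := sg m.+1.
exact: (Cm_linear (L := @entry R p i) oU (@entry_cont R p i) h).
Qed.

End Cm_comp.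

(** * Bump functions on R^n *)

(** The flat functions t^-k exp(-1/t), extended by 0 to t <= 0.  All exponents k
    are needed because differentiating produces the combination
    t^-(k+2) exp(-1/t) - k t^-(k+1) exp(-1/t) of the same family. *)
Definition flat (R : realType) (k : nat) (t : R) : R :=
  if 0 < t then t^-1 ^+ k * expR (- t^-1) else 0.

(** From u / (k+1) <= exp (u / (k+1)), raised to the power k. *)
Lemma powM_expRN_le (R : realType) k (u : R) : 0 <= u ->
  u ^+ k * expR (- u) <= k.+1%:R ^+ k.
Proof.
move=> u0.
have k0 : (0 : R) < k.+1%:R by rewrite ltr0n.
have h : (u / k.+1%:R) ^+ k <= expR u.
  have -> : expR u = expR (u / k.+1%:R) ^+ k.+1.
    by rewrite -expRM_natl mulrC divfK // gt_eqF.
  have e1 : 1 <= expR (u / k.+1%:R).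
    by rewrite -expR0 ler_expR divr_ge0 // ltW.
  apply: (@le_trans _ _ (expR (u / k.+1%:R) ^+ k)); last first.
    by rewrite exprS ler_peMl // exprn_ge0 // expR_ge0.
  have uk0 : 0 <= u / k.+1%:R by rewrite divr_ge0 // ltW.
  apply: lerXn2r; rewrite ?nnegrE ?expR_ge0 //.
  by apply: le_trans (expR_ge1Dx _); rewrite lerDr.
rewrite expRN ler_pdivrMr ?expR_gt0 //.
rewrite expr_div_n ler_pdivrMr ?exprn_gt0 // in h.
by rewrite mulrC.
Qed.

(** A quadratic bound: it makes the derivative at 0 vanish. *)
Lemma flat_le (R : realType) k (t : R) : `|flat k t| <= k.+3%:R ^+ k.+2 * t ^+ 2.
Proof.
rewrite /flat; case: ifP => [t0|_]; last first.
  by rewrite normr0; apply: mulr_ge0; [exact: exprn_ge0|exact: sqr_ge0].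
have i0 : 0 <= t^-1 by rewrite invr_ge0 ltW.
rewrite ger0_norm; last by apply: mulr_ge0; [exact: exprn_ge0|exact: expR_ge0].
have h := powM_expRN_le k.+2 i0.
rewrite -ler_pdivrMr ?exprn_gt0 //; apply: le_trans h.
rewrite -exprVn mulrAC -exprD addn2 //.
Qed.

Lemma is_derive_flat (R : realType) k (t : R) :
  is_derive t 1 (@flat R k) (flat k.+2 t - k%:R * flat k.+1 t).
Proof.
have [t0|t0|->] := ltgtP t 0.
- apply: (@near_eq_is_derive _ _ _ (cst 0)).
    near=> s; rewrite /flat /cst ifF //; apply/negbTE; rewrite -leNgt ltW //.
    by near: s; exact: lt_nbhsl.
  by rewrite /flat !ltNge !(ltW t0) /= mulr0 subr0; exact: is_derive_cst.
- pose g : R -> R := (fun s : R => s^-1) ^+ k * (expR \o (fun s : R => - s^-1)).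
  apply: (@near_eq_is_derive _ _ _ g).
    by near=> s; rewrite /flat ifT /g ?mulrfctE ?exprfctE //; near: s; exact: lt_nbhsr.
  rewrite /flat t0.
  have t1 : t != 0 by rewrite gt_eqF.
  have dV : is_derive t 1 (fun s : R => s^-1) (- t ^- 2).
    have D := @is_deriveV R id t 1 1 t1 (is_derive_id _ _).
    by apply: is_derive_eq D _; rewrite scaler1.
  have dE : is_derive t 1 (expR \o (fun s : R => - s^-1)) (expR (- t^-1) * t ^- 2).
    have D := @is_derive1_comp R expR (fun s : R => - s^-1) t _ _
      (is_derive_expR _) (is_deriveN dV).
    by apply: is_derive_eq D _; rewrite opprK.
  have dM := is_deriveM (is_deriveX k dV) dE.
  apply: is_derive_eq dM _; rewrite ?exprfctE /=.
  rewrite -!exprVn /GRing.scale /=.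
  by case: (k) => [|j] /=; rewrite ?exprS; ring.
- have l0 : (fun h : R => h^-1 *: (flat k (h *: 1 + 0) - flat k 0)) @ 0^' --> (0 : R).
    pose C : R := k.+3%:R ^+ k.+2.
    have C0 : (fun h : R => C * `|h|) @ 0^' --> (0 : R).
      rewrite -[X in _ --> X](mulr0 C).
      apply: cvgM; first exact: cvg_cst.
      have := @norm_continuous _ R^o 0; rewrite /continuous_at normr0.
      exact: cvg_within_filter.
    apply/norm_cvg0P; apply: squeeze_cvgr (cvg_cst 0) C0.
    near=> h; rewrite normr_ge0 /=.
    have h0 : h != 0 by near: h; exact: nbhs_dnbhs_neq.
    rewrite {2}/flat ltxx subr0 addr0 scaler1 normrZ normfV.
    rewrite ler_pdivrMl ?normr_gt0 // mulrCA -expr2 real_normK ?num_real //.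
    exact: flat_le.
  rewrite /flat ltxx mulr0 subr0.
  by apply: DeriveDef; [apply: cvgP l0|exact: cvg_lim l0].
Unshelve. all: by end_near. Qed.

Section flat_smooth.
Context {R : realType} {n : nat}.
Implicit Types (U : set 'rV[R]_n).

(** All derivatives of flat functions are combinations of flat functions, so an
    induction on m, for all k at once, only needs the chain rule. *)
Lemma Cm_flat m k U (f : 'rV[R]_n -> R) : open U -> smooth_on U f ->
  Cm m U (fun x => flat k (f x)).
Proof.
move=> oU sf.
have dflat j (t : R) : differentiable (@flat R j) t.
  by apply/derivable1_diffP; have [] := is_derive_flat j t.
elim: m k => [|m IH] k.
  move=> x Ux; apply: continuous_comp; first exact: sf 0%N _ Ux.
  exact: differentiable_continuous.
have dx x : U x -> differentiable (@flat R k \o f) x.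
  by move=> Ux; apply: differentiable_comp => //; exact: smooth_diff sf Ux.
split=> [x /dx //|v].
have [_ /(_ v) sdf] := sf m.+1.
apply: (Cm_ext (f := fun x => 'd f x v *: (flat k.+2 (f x) + (- k%:R : R) *: flat k.+1 (f x)))
   oU); last first.
  apply: CmZ => //; apply: CmD => //; apply: CmZ => //; exact: Cm_cst.
move=> x Ux.
transitivity ('d (@flat R k) (f x) ('d f x v)); last first.
  exact: esym (congr1 (@^~ v) (diff_comp (smooth_diff sf Ux) (dflat k (f x)))).
have D := is_derive_flat k (f x).
have Dd : derivable (@flat R k) (f x) 1 by case: D.
rewrite /= (deriv1E Dd) derive1E; have [_ ->] := D.
by rewrite /GRing.scale /= mulNr.
Qed.

Lemma Cm_id m U : Cm m U (id : 'rV[R]_n -> _).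
Proof.
case: m => [|m] /=; first by move=> x _; exact: cvg_id.
split=> [x _|v]; first by have [] := is_diff_id x.
apply: Cm_sub (subsetT U) _; apply: (Cm_ext (f := fun=> v)).
- exact: openT.
- by move=> x _; have [_ ->] := is_diff_id x.
- exact: Cm_cst.
Qed.

Lemma Cm_of_linear (W : normedModType R) m U (L : {linear 'rV[R]_n -> W}) :
  continuous L -> Cm m U L.
Proof.
move=> cL; apply: Cm_sub (subsetT U) _.
exact: (Cm_linear (f := id) openT cL (Cm_id _ _)).
Qed.

(** With q x = r^2 - |x - c|^2, the function psi = flat 0 \o q is positive exactly
    on the euclidean ball of radius r.  Composing once more with flat 0 at
    psi c / 2 - psi turns the neighbourhood of c where psi > psi c / 2 into a
    plateau, without any division by a function. *)
Lemma rV_bump (c : 'rV[R]_n) (r : R) : 0 < r -> exists phi : 'rV[R]_n -> R,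
  [/\ smooth_on setT phi, \forall x \near c, phi x = 1 &
      forall x, r <= `|x - c| -> phi x = 0].
Proof.
move=> r0.
pose q (x : 'rV[R]_n) : R := r ^+ 2 - \sum_(i < n) (x 0 i - c 0 i) ^+ 2.
have sq : smooth_on setT q.
  move=> m.
  have sc i : Cm m setT (fun x : 'rV[R]_n => x 0 i - c 0 i).
    apply: CmD openT _ (Cm_cst _ _ _).
    exact: (Cm_of_linear (L := @entry R n i) m setT (@entry_cont R n i)).
  apply: (Cm_ext (f := fun x => r ^+ 2 + (-1 : R) *:
     (\sum_(i < n) (x 0 i - c 0 i) *: (x 0 i - c 0 i) : R))) openT _ _.
    by move=> x _; rewrite /q scaleN1r.
  apply: CmD => //; [exact: openT|exact: Cm_cst|].
  apply: CmZ => //; [exact: openT|exact: Cm_cst|].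
  apply: Cm_sum; first exact: openT.
  by move=> i; apply: CmZ => //; exact: openT.
pose psi x := flat 0 (q x).
have spsi : smooth_on setT psi by move=> m; apply: Cm_flat => //; exact: openT.
have qc : q c = r ^+ 2.
  rewrite /q big1 ?subr0 // => i _; by rewrite subrr expr0n.
have flat0 t : 0 < t -> 0 < flat 0 t :> R.
  by move=> t0; rewrite /flat t0 expr0 mul1r expR_gt0.
(* Half of the maximum of psi, so that a < psi holds near c. *)
pose a := psi c / 2.
have pc0 : 0 < psi c by rewrite /psi qc flat0 // exprn_gt0.
have a0 : 0 < a by rewrite divr_gt0.
pose chi x := flat 0 (a + (-1 : R) *: psi x).
have schi : smooth_on setT chi.
  move=> m; apply: Cm_flat; first exact: openT.
  move=> m'; apply: CmD openT (Cm_cst _ _ _) _.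
  by apply: CmZ openT (Cm_cst _ _ _) _.
exists (fun x => 1 + (- (flat 0 a)^-1) *: chi x); split.
- move=> m; apply: CmD openT (Cm_cst _ _ _) _.
  by apply: CmZ openT (Cm_cst _ _ _) _.
- have cpsi : psi x @[x --> c] --> psi c by exact: spsi 0%N c I.
  have : \forall x \near c, a < psi x.
    apply: cvgr_gt cpsi _ _; rewrite /a; lra.
  apply: filterS => x ax; rewrite /chi scaleN1r.
  by rewrite {2}/flat ltNge subr_le0 (ltW ax) /= scaler0 addr0.
- move=> x rx.
  suff px : psi x = 0.
    rewrite /chi px scaler0 addr0 /GRing.scale /= mulNr mulVf ?subrr //.
    by rewrite gt_eqF // flat0.
  rewrite /psi /flat ifF //; apply/negbTE; rewrite -leNgt leNgt.
  apply/negP => qx; move: rx; apply/negP; rewrite -ltNge.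
  rewrite /Num.norm /= mx_normrE; apply: bigmax_lt => // -[i j] _ /=.
  rewrite ord1 !mxE -(ltr_pXn2r (n := 2)) ?nnegrE //; last exact: ltW.
  rewrite real_normK ?num_real //.
  apply: le_lt_trans (_ : \sum_(i < n) (x 0 i - c 0 i) ^+ 2 < _).
    by rewrite (bigD1 j) //= lerDl sumr_ge0 // => l _; exact: sqr_ge0.
  by move: qx; rewrite subr_gt0.
Qed.

End flat_smooth.

(** * Smooth functions on a manifold *)

Section Mfd.
Context {R : realType} {n : nat} {M : mfd R n}.
Hypothesis hM : is_manifold M.
Implicit Types (U V W : set (pt M)) (i j : idx M).

Lemma mopen_dom i : mopen (dom i).
Proof. by case: hM. Qed.

Lemma dom_car i x : dom i x -> car M x.
Proof. by case: (mopen_dom i) => + _; apply. Qed.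

Lemma at_dom x : car M x -> dom (at_ x) x.
Proof. by case: hM => _ [h _]; exact: h. Qed.

Lemma bwdK i x : dom i x -> bwd i (fwd i x) = x.
Proof. by case: hM => _ [_ [h _]]; exact: h. Qed.

Lemma smooth_transition i j :
  smooth_on (fwd i @` (dom i `&` dom j)) (fwd j \o bwd i).
Proof. by case: hM => _ [_ [_ [h _]]]. Qed.

Lemma chart_open i W : mopen W -> open (fwd i @` (dom i `&` W)).
Proof. by case. Qed.

Lemma mopen_car : mopen (car M).
Proof.
split=> // i; have [_ /(_ i)] := mopen_dom i.
by rewrite setIid (_ : dom i `&` car M = dom i) //; apply/setIidl => x /dom_car.
Qed.

Lemma mopenI U V : mopen U -> mopen V -> mopen (U `&` V).
Proof.
move=> [Uc oU] [Vc oV]; split=> [x [/Uc]//|i].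
rewrite (_ : fwd i @` _ = fwd i @` (dom i `&` U) `&` fwd i @` (dom i `&` V)).
  exact: openI.
apply/seteqP; split=> [_ [x [dx [Ux Vx]] <-]|_ [[x [dx Ux] <-] [y [dy Vy] e]]].
  by split; exists x.
have xy : x = y by rewrite -(bwdK dx) -(bwdK dy) e.
by exists x => //; split => //; split => //; rewrite xy.
Qed.

Lemma mopen_preimage i (O : set 'rV[R]_n) : open O ->
  mopen (dom i `&` fwd i @^-1` O).
Proof.
move=> oO; split=> [x [/dom_car]//|j].
pose D := fwd j @` (dom j `&` dom i).
have oD : open D := chart_open (mopen_dom i).
rewrite (_ : fwd j @` _ = D `&` (fwd i \o bwd j) @^-1` O).
  rewrite openE => z [Dz Oz]; apply: filterI; first exact: open_near.
  apply: (@smooth_transition j i 0%N z Dz); exact: open_near.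
apply/seteqP; split=> [_ [x [dx [dxi Ox]] <-]|_ [[x [dx dxi] <-]]] /=.
  by split; [exists x|rewrite bwdK].
by rewrite bwdK // => Ox; exists x.
Qed.

(** How an open set of the manifold is used inside a chart: the representation
    of points by bwd i is faithful near fwd i x. *)
Lemma near_chart i W x : mopen W -> W x -> dom i x ->
  \forall z \near fwd i x, [/\ W (bwd i z), dom i (bwd i z) & fwd i (bwd i z) = z].
Proof.
move=> oW Wx dx; have o := chart_open (i := i) oW.
have : (fwd i @` (dom i `&` W)) (fwd i x) by exists x.
move=> /(open_near o); apply: filterS => _ [y [dy Wy] <-].
by rewrite bwdK.
Qed.

Section Msmooth.
Context {F : normedModType R}.
Implicit Types f g : pt M -> F.

Lemma msmooth_ext U f g : mopen U -> (forall x, U x -> f x = g x) ->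
  msmooth U f -> msmooth U g.
Proof.
move=> oU fg sf i m; apply: Cm_ext (sf i m); first exact: chart_open.
by move=> _ [x [dx Ux] <-] /=; rewrite bwdK // fg.
Qed.

Lemma msmooth_sub U V f : V `<=` U -> msmooth U f -> msmooth V f.
Proof.
move=> VU sf i m; apply: Cm_sub (sf i m).
by move=> _ [x [dx Vx] <-]; exists x => //; split => //; exact: VU.
Qed.

Lemma msmooth_glue U f :
  (forall x, U x -> exists2 V, V x & msmooth V f) -> msmooth U f.
Proof.
move=> h i m; apply: Cm_glue => _ [x [dx Ux] <-].
have [V Vx sf] := h x Ux.
by exists (fwd i @` (dom i `&` V)); [exists x|exact: sf].
Qed.

Lemma msmooth_cst U (w : F) : msmooth U (fun=> w).
Proof. by move=> i m; exact: Cm_cst. Qed.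

Lemma msmoothD U f g : mopen U -> msmooth U f -> msmooth U g ->
  msmooth U (fun x => f x + g x).
Proof.
by move=> oU sf sg i m; apply: CmD (sf i m) (sg i m); exact: chart_open.
Qed.

Lemma msmoothZ U (h : pt M -> R) f : mopen U -> msmooth U h -> msmooth U f ->
  msmooth U (fun x => h x *: f x).
Proof.
by move=> oU sf sg i m; apply: CmZ (sf i m) (sg i m); exact: chart_open.
Qed.

Lemma msmooth_sum U (I : Type) (r : seq I) (f : I -> pt M -> F) : mopen U ->
  (forall l, msmooth U (f l)) -> msmooth U (fun x => \sum_(l <- r) f l x).
Proof.
move=> oU h i m; apply: Cm_sum => [|l]; [exact: chart_open|exact: h].
Qed.

(** Smoothness on a chart domain can be tested in that chart, transition maps
    being smooth. *)
Lemma msmooth_chart i U f : mopen U ->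
  smooth_on (fwd i @` (dom i `&` U)) (f \o bwd i) -> msmooth (dom i `&` U) f.
Proof.
move=> oU sf j m.
have oD : open (fwd j @` (dom j `&` (dom i `&` U))).
  by apply: chart_open; apply: mopenI => //; exact: mopen_dom.
apply: (Cm_ext (f := (f \o bwd i) \o (fwd i \o bwd j)) oD).
  by move=> _ [x [dx [dix Ux]] <-] /=; rewrite !bwdK.
apply: Cm_comp (sf m) => //.
  by move=> _ [x [dx [dix Ux]] <-] /=; exists x => //; rewrite bwdK.
move=> m'; apply: Cm_sub (@smooth_transition j i m').
by move=> _ [x [dx [dix Ux]] <-] /=; exists x.
Qed.

Lemma msmooth_diff i U f x : msmooth U f -> U x -> dom i x ->
  differentiable (f \o bwd i) (fwd i x).
Proof. by move=> sf Ux dx; apply: smooth_diff (sf i) _; exists x. Qed.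

End Msmooth.

Lemma msmooth_linear (F F' : normedModType R) (L : {linear F -> F'}) U
    (f : pt M -> F) : continuous L -> mopen U -> msmooth U f ->
  msmooth U (fun x => L (f x)).
Proof.
by move=> cL oU sf i m; apply: Cm_linear (sf i m) => //; exact: chart_open.
Qed.

(** The image in the manifold of a closed coordinate ball is compact, hence
    closed by the Hausdorff axiom.  Compactness is used in near-covering form,
    for the filter of neighbourhoods of y, so that no finite cover has to be
    extracted. *)
Lemma separate_closed_ball i x y (r : R) :
  0 < r -> car M y -> closed_ball (fwd i x) r `<=` fwd i @` dom i ->
  (forall z, dom i z -> closed_ball (fwd i x) r (fwd i z) -> y <> z) ->
  exists V, [/\ mopen V, V y &
    forall z, V z -> dom i z -> ~ closed_ball (fwd i x) r (fwd i z)].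
Proof.
move=> r0 cy Bdom Bfwd; set B := closed_ball _ _ in Bdom Bfwd *.
have cB : compact B.
  apply: bounded_closed_compact; last exact: closed_ball_closed.
  exists (`|fwd i x| + r); split; first exact: num_real.
  move=> M' hM' z; rewrite /B closed_ballE // /closed_ball_ /= => zr.
  apply: le_trans (ltW hM'); rewrite -lerBlDl; apply: le_trans zr.
  by rewrite distrC; exact: lerB_dist.
pose F : set_system (pt M) := [set A | exists2 V, mopen V /\ V y & V `<=` A].
have FF : Filter F.
  split; first by exists (car M) => //; split => //; exact: mopen_car.
    move=> A A' [V [oV Vy] VA] [V' [oV' Vy'] VA'].
    exists (V `&` V'); first by split => //; exact: mopenI.
    by move=> z [/VA ? /VA' ?].
  by move=> A A' AA' [V ? VA]; exists V => // z /VA /AA'.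
have /compact_near_coveringP/(_ _ F (fun p z => p <> bwd i z)) := cB.
move=> /(_ FF) [].
  move=> w Bw; have [z dz zw] := Bdom w Bw.
  have yz : y <> z by apply: Bfwd => //; rewrite zw.
  case: hM => _ [_ [_ [_ [/(_ y z cy (dom_car dz) yz) + _]]]].
  move=> [V [W [oV oW Vy Wz VW0]]].
  exists ((fwd i @` (dom i `&` W)), V) => /=.
    split; last by exists V.
    by apply: open_near; [exact: chart_open|rewrite -zw; exists z].
  move=> [p q] /= [[u [du Wu] <-] Vq]; rewrite bwdK // => qu.
  by have : (V `&` W) q; [split => //; rewrite qu|rewrite VW0].
move=> V [oV Vy] VP; exists V; split=> // z Vz dz Bz.
by apply: (VP z Vz _ Bz); rewrite bwdK.
Qed.

(** A bump function of a coordinate ball extended by 0.  Smoothness of the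
    extension outside the chart domain comes from the fact that the ball is
    closed in the manifold; the last clause records the resulting neighbourhoods,
    since multiplying by phi is how local objects on W are made global. *)
Lemma mfd_bump W x : mopen W -> W x -> exists (phi : pt M -> R) V,
  [/\ msmooth (car M) phi, mopen V /\ V x, forall y, V y -> phi y = 1,
      forall y, ~ W y -> phi y = 0 &
      forall y, car M y -> ~ W y ->
        exists V', [/\ mopen V', V' y & forall z, V' z -> phi z = 0]].
Proof.
move=> oW Wx; have cx : car M x by case: oW => + _; apply.
pose i := at_ x; have dx : dom i x := at_dom cx.
have : nbhs (fwd i x) (fwd i @` (dom i `&` W)).
  by apply: open_near; [exact: chart_open|exists x].
rewrite nbhs_closedballP => -[r Br].
have r0 : 0 < r%:num by [].
have [psi [spsi psi1 psi0]] := rV_bump (fwd i x) r0.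
pose phi y := if `[< dom i y >] then psi (fwd i y) else 0.
have phiE y : dom i y -> phi y = psi (fwd i y) by move=> dy; rewrite /phi asboolT.
have far y : car M y ->
    (forall z, dom i z -> closed_ball (fwd i x) r%:num (fwd i z) -> y <> z) ->
    exists V', [/\ mopen V', V' y & forall z, V' z -> phi z = 0].
  move=> cy yB.
  have Bd : closed_ball (fwd i x) r%:num `<=` fwd i @` dom i.
    by move=> z /Br [u [du _] <-]; exists u.
  have [V [oV Vy V0]] := separate_closed_ball r0 cy Bd yB.
  exists V; split=> // z Vz; rewrite /phi; case: asboolP => // dz.
  have := V0 z Vz dz; rewrite closed_ballE // /closed_ball_ /= => /negP.
  by rewrite -ltNge distrC => /ltW; exact: psi0.
have [V [oV Vx V1]] : exists V, [/\ mopen V, V x & forall y, V y -> phi y = 1].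
  have : nbhs (fwd i x) [set z | psi z = 1] by [].
  rewrite nbhsE => -[D [oD Dx] D1].
  exists (dom i `&` fwd i @^-1` D); split=> //; first exact: mopen_preimage.
  by move=> y [dy /D1]; rewrite phiE.
exists phi, V; split=> //.
- apply: msmooth_glue => y cy.
  have [dy|ndy] := pselect (dom i y).
    exists (dom i `&` dom i) => //.
    apply: (msmooth_ext (f := psi \o fwd i)); last first.
    + apply: msmooth_chart; first exact: mopen_dom.
      move=> m; apply: (Cm_ext (f := psi)); last exact: Cm_sub (spsi m).
      * apply: chart_open; exact: mopen_dom.
      * by move=> _ [z [dz _] <-] /=; rewrite bwdK.
    + by move=> z [dz _]; rewrite phiE.
    + by apply: mopenI; exact: mopen_dom.
  have [z dz _ yz|V' [oV' Vy' V0]] := far y cy; first by apply: ndy; rewrite yz.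
  exists V' => //; apply: (msmooth_ext (f := fun=> 0)) => //.
    by move=> z /V0 ->.
  exact: msmooth_cst.
- move=> y nWy; rewrite /phi; case: asboolP => // dy; apply: psi0.
  rewrite leNgt; apply/negP => yr; apply: nWy.
  have /Br[u [du Wu] uy] : closed_ball (fwd i x) r%:num (fwd i y).
    by rewrite closed_ballE // /closed_ball_ /= distrC ltW.
  by rewrite -(bwdK dy) -uy bwdK.
- move=> y cy nWy; apply: far => // z dz /Br [u [du Wu] uz] yz; apply: nWy.
  by rewrite yz -(bwdK dz) -uz bwdK.
Qed.

End Mfd.

(** * Sections and one-forms of a vector bundle *)

Section Bundle.
Context {R : realType} {n r : nat} {M : mfd R n} {E : vbundle M r}.
Hypothesis hM : is_manifold M.
Hypothesis hE : is_vbundle E.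
Implicit Types (W V : set (pt M)) (t : tidx E) (s : sect E).

Lemma fmem0 x : car M x -> fmem (0 : fib E x).
Proof. by case: hE => h _ /h[]. Qed.

Lemma fmem_lin x (a : R) (u v : fib E x) : car M x ->
  fmem u -> fmem v -> fmem (a *: u + v).
Proof. by case: hE => h _ /h[_]; apply. Qed.

Lemma fmemZ x (a : R) (u : fib E x) : car M x -> fmem u -> fmem (a *: u).
Proof. by move=> cx mu; rewrite -[X in fmem X]addr0; apply: fmem_lin => //; exact: fmem0. Qed.

Lemma fmemD x (u v : fib E x) : car M x -> fmem u -> fmem v -> fmem (u + v).
Proof. by move=> cx mu mv; rewrite -[u]scale1r; exact: fmem_lin. Qed.

Lemma mopen_tdom t : mopen (tdom t).
Proof. by case: hE => _ [h _]. Qed.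

Lemma tdom_car t x : tdom t x -> car M x.
Proof. by case: (mopen_tdom t) => + _; apply. Qed.

Lemma tat_dom x : car M x -> tdom (tat E x) x.
Proof. by case: hE => _ [_ [h _]]; exact: h. Qed.

Lemma tinv_mem t x v : tdom t x -> fmem (tinv t x v).
Proof. by case: hE => _ [_ [_ [h _]]] /(h t)[]. Qed.

Lemma tinv_lin t x (a : R) v w : tdom t x ->
  tinv t x (a *: v + w) = a *: tinv t x v + tinv t x w.
Proof. by case: hE => _ [_ [_ [h _]]] /(h t)[_ + _ _]; apply. Qed.

Lemma tinvK t x : tdom t x -> cancel (tinv t x) (tcrd t (x := x)).
Proof. by case: hE => _ [_ [_ [h _]]] /(h t)[]. Qed.

Lemma tcrdK t x (u : fib E x) : tdom t x -> fmem u -> tinv t x (tcrd t u) = u.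
Proof. by case: hE => _ [_ [_ [h _]]] /(h t)[_ _ _]; apply. Qed.

Lemma smooth_tcrd t t' v :
  msmooth (tdom t `&` tdom t') (fun x => tcrd t' (tinv t x v)).
Proof. by case: hE => _ [_ [_ [_ h]]]; exact: h. Qed.

Lemma tinv0 t x : tdom t x -> tinv t x 0 = 0.
Proof.
move=> tx; have := tinv_lin (-1) 0 0 tx.
by rewrite scaler0 addr0 scaleN1r addNr.
Qed.

Lemma tcrd_lin t x (a : R) (u v : fib E x) : tdom t x -> fmem u -> fmem v ->
  tcrd t (a *: u + v) = a *: tcrd t u + tcrd t v.
Proof.
by move=> tx mu mv; rewrite -{1}(tcrdK tx mu) -{1}(tcrdK tx mv) -tinv_lin // tinvK.
Qed.

Lemma tcrd0 t x : tdom t x -> tcrd t (0 : fib E x) = 0.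
Proof. by move=> tx; rewrite -(tinv0 tx) tinvK. Qed.

Lemma tcrdD t x (u v : fib E x) : tdom t x -> fmem u -> fmem v ->
  tcrd t (u + v) = tcrd t u + tcrd t v.
Proof. by move=> tx mu mv; rewrite -[u]scale1r tcrd_lin // !scale1r. Qed.

Lemma tcrdZ t x (a : R) (u : fib E x) : tdom t x -> fmem u ->
  tcrd t (a *: u) = a *: tcrd t u.
Proof.
move=> tx mu; have m0 := fmem0 (tdom_car tx).
by rewrite -[a *: u]addr0 tcrd_lin // tcrd0 // addr0.
Qed.

Lemma tinv_sum t x v : tdom t x ->
  tinv t x v = \sum_(a < r) v 0 a *: tinv t x (delta_mx 0 a).
Proof.
move=> tx; rewrite {1}[v]row_sum_delta.
elim/big_rec2: _ => [|a u w _ <-]; first exact: tinv0.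
exact: tinv_lin.
Qed.

Lemma eq_sect s s' : (forall x, s x = s' x) -> s = s'.
Proof. exact: functional_extensionality_dep. Qed.

Lemma smooth_sectZ (f : pt M -> R) s : msmooth (car M) f -> smooth_sect s ->
  smooth_sect (fun x => f x *: s x).
Proof.
move=> sf [ms ss]; split=> [x cx|t]; first by apply: fmemZ => //; exact: ms.
apply: (msmooth_ext hM (f := fun x => f x *: tcrd t (s x)) (mopen_tdom t)).
  by move=> x tx; rewrite tcrdZ //; exact: ms (tdom_car tx).
apply: msmoothZ => //; first exact: mopen_tdom.
by apply: msmooth_sub sf => x /tdom_car.
Qed.

Lemma smooth_sectD s s' : smooth_sect s -> smooth_sect s' ->
  smooth_sect (fun x => s x + s' x).
Proof.
move=> [ms ss] [ms' ss']; split=> [x cx|t].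
  by apply: fmemD => //; [exact: ms|exact: ms'].
apply: (msmooth_ext hM (f := fun x => tcrd t (s x) + tcrd t (s' x)) (mopen_tdom t)).
  by move=> x tx; rewrite tcrdD //; [exact: ms (tdom_car tx)|exact: ms' (tdom_car tx)].
by apply: msmoothD => //; exact: mopen_tdom.
Qed.

Lemma smooth_sect0 : smooth_sect (fun x => 0 : fib E x).
Proof.
split=> [x|t]; first exact: fmem0.
apply: (msmooth_ext hM (f := fun=> 0) (mopen_tdom t)).
  by move=> x tx; rewrite tcrd0.
exact: msmooth_cst.
Qed.

Lemma smooth_sect_sum (I : Type) (l : seq I) (S : I -> sect E) :
  (forall i, smooth_sect (S i)) -> smooth_sect (fun x => \sum_(i <- l) S i x).
Proof.
move=> h; elim: l => [|i l IH].
  have -> : (fun x => \sum_(i <- [::]) S i x) = (fun x => 0) :> sect E.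
    by apply: eq_sect => x; rewrite big_nil.
  exact: smooth_sect0.
have -> : (fun x => \sum_(i <- i :: l) S i x) =
          (fun x => S i x + \sum_(i <- l) S i x) :> sect E.
  by apply: eq_sect => x; rewrite big_cons.
exact: smooth_sectD.
Qed.

Lemma smooth_sectB s s' : smooth_sect s -> smooth_sect s' ->
  smooth_sect (fun x => s x - s' x).
Proof.
move=> ss ss'.
have -> : (fun x => s x - s' x) = (fun x => s x + (-1) *: s' x) :> sect E.
  by apply: eq_sect => x; rewrite scaleN1r.
by apply: smooth_sectD => //; apply: smooth_sectZ => //; exact: msmooth_cst.
Qed.

(** Brackets and exterior differentials only take global sections; this and
    [extend_fun] supply enough sections and functions to compute with them in a
    local basis. *)
Lemma local_frame t x v : tdom t x -> exists s,
  smooth_sect s /\ Defs.eq_near x s (fun y => tinv t y v).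
Proof.
move=> tx.
have [phi [V [sphi [oV Vx] V1 off far]]] := mfd_bump hM (mopen_tdom t) tx.
exists (fun y => phi y *: tinv t y v); split; last first.
  by exists V; split => // y Vy; rewrite V1 // scale1r.
split=> [y cy|t'].
  have [ty|nty] := pselect (tdom t y); first by apply: fmemZ => //; exact: tinv_mem.
  by rewrite off // scale0r; exact: fmem0.
have sub : tdom t' `<=` car M by move=> y /tdom_car.
have oI := mopenI hM (mopen_tdom t) (mopen_tdom t').
apply: msmooth_glue => y ty'; have [ty|nty] := pselect (tdom t y).
  exists (tdom t `&` tdom t') => //.
  apply: (msmooth_ext hM (f := fun z => phi z *: tcrd t' (tinv t z v)) oI).
    by move=> z [tz tz']; rewrite tcrdZ //; exact: tinv_mem.
  apply: msmoothZ => //; last exact: smooth_tcrd.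
  by apply: msmooth_sub sphi => z [_ /sub].
have [V' [oV' Vy' V0]] := far y (sub _ ty') nty.
exists (tdom t' `&` V') => //.
apply: (msmooth_ext hM (f := fun=> 0)); last exact: msmooth_cst.
  by apply: mopenI => //; exact: mopen_tdom.
by move=> z [tz Vz]; rewrite V0 // scale0r tcrd0.
Qed.

Lemma extend_fun W x (f : pt M -> R) : mopen W -> W x -> msmooth W f ->
  exists (g : pt M -> R) V, [/\ msmooth (car M) g, mopen V, V x &
    forall y, V y -> g y = f y].
Proof.
move=> oW Wx sf.
have [phi [V [sphi [oV Vx] V1 off far]]] := mfd_bump hM oW Wx.
exists (fun y => phi y *: f y), V; split=> //; last first.
  by move=> y Vy; rewrite V1 // scale1r.
apply: msmooth_glue => y cy; have [Wy|nWy] := pselect (W y).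
  exists W => //; apply: msmoothZ => //; apply: msmooth_sub sphi.
  by case: oW.
have [V' [oV' Vy' V0]] := far y cy nWy.
exists V' => //; apply: (msmooth_ext hM (f := fun=> 0)) => //; last exact: msmooth_cst.
by move=> z Vz; rewrite V0 // scale0r.
Qed.

(** Turns an identity between values of global sections into a statement about
    vectors. *)
Lemma sect_through x (u : fib E x) : car M x -> fmem u ->
  exists s, smooth_sect s /\ s x = u.
Proof.
move=> cx mu; have tx := tat_dom cx.
have [s [ss [V [oV Vx sV]]]] := local_frame (tcrd (tat E x) u) tx.
by exists s; split => //; rewrite sV // tcrdK.
Qed.

Section Forms.
Variables (mu : Defs.form E).
Hypothesis fmu : is_form 1 mu.

Lemma form1_lin x (a : R) (u v : fib E x) : car M x -> fmem u -> fmem v ->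
  mu [:: a *: u + v] = a * mu [:: u] + mu [:: v].
Proof.
move=> cx mu1 mv; case: fmu => + _ => /(_ x [::] [::] a u v cx erefl).
by apply=> w; rewrite !inE => /orP[/eqP->|/eqP->].
Qed.

Lemma form10 x : car M x -> mu [:: (0 : fib E x)] = 0.
Proof.
move=> cx; have m0 := fmem0 cx.
have := form1_lin (-1) cx m0 m0; rewrite scaler0 addr0 mulN1r addNr //.
Qed.

Lemma form1D x (u v : fib E x) : car M x -> fmem u -> fmem v ->
  mu [:: u + v] = mu [:: u] + mu [:: v].
Proof. by move=> cx mu1 mv; rewrite -[u]scale1r form1_lin // !scale1r mul1r. Qed.

Lemma form1Z x (a : R) (u : fib E x) : car M x -> fmem u ->
  mu [:: a *: u] = a * mu [:: u].
Proof.
by move=> cx mu1; rewrite -[a *: u]addr0 form1_lin ?form10 ?addr0 //; exact: fmem0.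
Qed.

Lemma form1_sum x (I : Type) (l : seq I) (u : I -> fib E x) : car M x ->
  (forall i, fmem (u i)) ->
  mu [:: \sum_(i <- l) u i] = \sum_(i <- l) mu [:: u i].
Proof.
move=> cx mu1; have : fmem (\sum_(i <- l) u i) /\
    mu [:: \sum_(i <- l) u i] = \sum_(i <- l) mu [:: u i]; last by case.
elim: l => [|i l [IH1 IH2]]; first by rewrite !big_nil form10 //; split=> //; exact: fmem0.
by rewrite !big_cons form1D // IH2; split => //; exact: fmemD.
Qed.

(** In a local basis mu (s) is the sum of the coordinates of s times the values
    of mu on the basis. *)
Lemma smooth_form1 s : smooth_sect s -> msmooth (car M) (fun x => mu [:: s x]).
Proof.
move=> [ms ss]; apply: msmooth_glue => x cx.
exists (tdom (tat E x)); first exact: tat_dom.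
set t := tat E x; have ot := mopen_tdom t.
apply: (msmooth_ext hM (f := fun y => \sum_a
   (tcrd t (s y) 0 a) *: (mu [:: tinv t y (delta_mx 0 a)] : R)) ot).
  move=> y ty; have cy := tdom_car ty; rewrite -[in RHS](tcrdK ty (ms _ cy)) tinv_sum //.
  rewrite form1_sum //; last first.
    by move=> a; apply: fmemZ => //; exact: tinv_mem.
  apply: eq_bigr => a _; rewrite form1Z //; exact: tinv_mem.
apply: msmooth_sum => // a; apply: msmoothZ => //.
  exact: (msmooth_linear (L := @entry R r a) (@entry_cont R r a) ot (ss t)).
case: fmu => _ [_ /(_ t [:: delta_mx 0 a] erefl)]; exact.
Qed.

End Forms.

End Bundle.

(** * The exterior differential of a one-form *)

Section Der.
Context {R : realType} {n : nat} {M : mfd R n}.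
Hypothesis hM : is_manifold M.
Implicit Types (f g : pt M -> R) (x : pt M).

Lemma der_diff x f : msmooth (car M) f -> car M x ->
  differentiable (f \o bwd (at_ x)) (fwd (at_ x) x).
Proof. move=> sf cx; exact: (msmooth_diff sf cx (at_dom hM cx)). Qed.

Lemma der_lin x (a : R) v w f : der x (a *: v + w) f = a * der x v f + der x w f.
Proof. by rewrite /der linearP. Qed.

Lemma derZ x (a : R) v f : der x (a *: v) f = a * der x v f.
Proof. by rewrite /der linearZ. Qed.

Lemma der_addv x v w f : der x (v + w) f = der x v f + der x w f.
Proof. by rewrite /der linearD. Qed.

Lemma derM x v f g : msmooth (car M) f -> msmooth (car M) g -> car M x ->
  der x v (fun y => f y * g y) = f x * der x v g + der x v f * g x.
Proof.
move=> sf sg cx.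
have [_] := diff_scale (der_diff sf cx) (der_diff sg cx).
by move=> /(congr1 (@^~ v)); rewrite /der /= !(bwdK hM (at_dom hM cx)).
Qed.

Lemma derD x v f g : msmooth (car M) f -> msmooth (car M) g -> car M x ->
  der x v (fun y => f y + g y) = der x v f + der x v g.
Proof.
move=> sf sg cx.
by have /(congr1 (@^~ v)) := diffD (der_diff sf cx) (der_diff sg cx).
Qed.

Lemma der_near x v f g V : msmooth (car M) f -> mopen V -> V x ->
  (forall y, V y -> f y = g y) -> der x v f = der x v g.
Proof.
move=> sf oV Vx fg; rewrite /der.
have cx : car M x by case: oV => + _; apply.
have nc := near_chart hM oV Vx (at_dom hM cx).
have [] := @near_eq_diff R _ _ _ (g \o bwd (at_ x)) _ _ (der_diff sf cx).
  by apply: filterS nc => z [Vz _ _] /=; rewrite fg.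
by move=> _ /(congr1 (@^~ v)) e; exact: esym e.
Qed.

Lemma der_cst_near x v f (c : R) V : mopen V -> V x ->
  (forall y, V y -> f y = c) -> der x v f = 0.
Proof.
move=> oV Vx fc; rewrite -(der_near (f := fun=> c) _ _ oV Vx) //.
- by rewrite /der; have -> := diff_cst c (fwd (at_ x) x).
- exact: msmooth_cst.
- by move=> y /fc.
Qed.

End Der.

Section Ext.
Context {R : realType} {n r : nat} {M : mfd R n} {E : algd M r}.
Hypothesis hE : is_lie_algebroid E.
Implicit Types (S T : sect E) (x : pt M).

Let hM : is_manifold M := hE.1.
Let hV : is_vbundle E := hE.2.1.

Lemma anchor_lin x (a : R) (u v : fib E x) : car M x -> fmem u -> fmem v ->
  anchor (a *: u + v) = a *: anchor u + anchor v.
Proof. by case: hE => _ [_ [[_ [_ [h _]]] _]]; exact: h. Qed.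

Lemma anchor0 x : car M x -> anchor (0 : fib E x) = 0.
Proof.
move=> cx; have m0 := fmem0 hV cx.
by have := anchor_lin (-1) cx m0 m0; rewrite scaler0 addr0 scaleN1r addNr.
Qed.

Lemma anchorZ x (a : R) (u : fib E x) : car M x -> fmem u ->
  anchor (a *: u) = a *: anchor u.
Proof.
move=> cx mu; have m0 := fmem0 hV cx.
by rewrite -[X in anchor X]addr0 anchor_lin // anchor0 // addr0.
Qed.

Lemma smooth_bracket S T : smooth_sect S -> smooth_sect T ->
  smooth_sect (bracket S T).
Proof. by case: hE => _ [_ [_ [h _]]]; exact: h. Qed.

Lemma bracket_lin (a : R) S1 S2 S x : smooth_sect S1 -> smooth_sect S2 ->
  smooth_sect S -> car M x ->
  bracket (fun y => a *: S1 y + S2 y) S x = a *: bracket S1 S x + bracket S2 S x.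
Proof. by case: hE => _ [_ [_ [_ [h _]]]]; exact: h. Qed.

Lemma bracketC S T x : smooth_sect S -> smooth_sect T -> car M x ->
  bracket S T x = - bracket T S x.
Proof. by case: hE => _ [_ [_ [_ [_ [h _]]]]]; exact: h. Qed.

Lemma bracket_leibniz (f : pt M -> R) S T x : msmooth (car M) f ->
  smooth_sect S -> smooth_sect T -> car M x ->
  bracket S (fun y => f y *: T y) x =
    f x *: bracket S T x + der x (anchor (S x)) f *: T x.
Proof. by case: hE => _ [_ [_ [_ [_ [_ [_ h]]]]]]; exact: h. Qed.

Variable mu : Defs.form E.
Hypothesis fmu : is_form 1 mu.

Lemma ext_diff2 S T x : ext_diff mu [:: S; T] x =
  der x (anchor (S x)) (fun y => mu [:: T y]) -
  der x (anchor (T x)) (fun y => mu [:: S y]) -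
  mu [:: bracket S T x].
Proof.
rewrite /ext_diff /= !big_ord_recl !big_ord0 /=.
rewrite !big_mkcond /= !big_ord_recl !big_ord0 /=.
rewrite /bump /= !addr0 !add0n !addn0 ?add0r expr0 expr1 mul1r !mulN1r.
by rewrite (big_mkcond (fun j : 'I_2 => (1 < j)%N)) !big_ord_recl big_ord0 /= !addr0.
Qed.

Lemma ext_diffC S T x : smooth_sect S -> smooth_sect T -> car M x ->
  ext_diff mu [:: S; T] x = - ext_diff mu [:: T; S] x.
Proof.
move=> sS sT cx; rewrite !ext_diff2 (bracketC sS sT cx) -scaleN1r.
have [ms _] := smooth_bracket sT sS.
rewrite (form1Z hV fmu) //; last exact: ms.
ring.
Qed.

(** Linearity over functions: in d mu (S, f T) the term (rho(S) f) mu(T) of the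
    product rule is cancelled by the one that the Leibniz rule of the bracket
    contributes. *)
Lemma ext_diffZ (f : pt M -> R) S T x : msmooth (car M) f ->
  smooth_sect S -> smooth_sect T -> car M x ->
  ext_diff mu [:: S; (fun y => f y *: T y)] x = f x * ext_diff mu [:: S; T] x.
Proof.
move=> sf sS sT cx; have [mT _] := sT; have [mb _] := smooth_bracket sS sT.
have mTx := mT _ cx; have mbx := mb _ cx.
have E1 v : der x v (fun y => mu [:: f y *: T y]) =
    f x * der x v (fun y => mu [:: T y]) + der x v f * mu [:: T x].
  have sm := smooth_form1 hM hV fmu sT.
  transitivity (der x v (fun y => f y * mu [:: T y])); last exact: derM.
  symmetry; apply: (der_near hM _ _ (mopen_car hM) cx).
    exact: msmoothZ (mopen_car hM) sf sm.
  by move=> y cy; rewrite (form1Z hV fmu) //; exact: mT.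
rewrite !ext_diff2 bracket_leibniz // E1 anchorZ //.
rewrite (form1_lin fmu) //; last exact: fmemZ.
rewrite (form1Z hV fmu) // derZ.
move: (der _ _ _) (der _ _ _) (der _ _ _) => d1 d2 d3.
ring.
Qed.

Lemma ext_diffD S T T' x : smooth_sect S -> smooth_sect T -> smooth_sect T' ->
  car M x ->
  ext_diff mu [:: S; (fun y => T y + T' y)] x =
    ext_diff mu [:: S; T] x + ext_diff mu [:: S; T'] x.
Proof.
move=> sS sT sT' cx; have [mT _] := sT; have [mT' _] := sT'.
have [mb _] := smooth_bracket sT sS; have [mb' _] := smooth_bracket sT' sS.
have sTT := smooth_sectD hM hV sT sT'.
rewrite (ext_diffC sS sTT cx) (ext_diffC sS sT cx) (ext_diffC sS sT' cx).
rewrite -opprD; congr (- _).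
have E1 v : der x v (fun y => mu [:: T y + T' y]) =
    der x v (fun y => mu [:: T y]) + der x v (fun y => mu [:: T' y]).
  have sm := smooth_form1 hM hV fmu sT; have sm' := smooth_form1 hM hV fmu sT'.
  transitivity (der x v (fun y => mu [:: T y] + mu [:: T' y])); last exact: derD.
  symmetry; apply: (der_near hM _ _ (mopen_car hM) cx).
    exact: msmoothD (mopen_car hM) sm sm'.
  by move=> y cy; rewrite (form1D fmu) //; [exact: mT|exact: mT'].
have E2 : anchor (T x + T' x) = anchor (T x) + anchor (T' x).
  by rewrite -[T x]scale1r anchor_lin ?scale1r //; [exact: mT|exact: mT'].
have E3 : bracket (fun y => T y + T' y) S x = bracket T S x + bracket T' S x.
  rewrite -[X in _ = X + _]scale1r -bracket_lin //; congr (bracket _ S x).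
  by apply: eq_sect => y; rewrite scale1r.
rewrite !ext_diff2 E1 E2 E3 (form1D fmu); [|by []|exact: mb|exact: mb'].
rewrite der_addv.
move: (der _ _ _) (der _ _ _) (der _ _ _) (der _ _ _) => d1 d2 d3 d4.
ring.
Qed.

Lemma ext_diff_sum (I : Type) (l : seq I) (f : I -> pt M -> R) S (T : I -> sect E) x :
  smooth_sect S -> (forall i, smooth_sect (T i)) ->
  (forall i, msmooth (car M) (f i)) -> car M x ->
  ext_diff mu [:: S; (fun y => \sum_(i <- l) f i y *: T i y)] x =
    \sum_(i <- l) f i x * ext_diff mu [:: S; T i] x.
Proof.
move=> sS sT sf cx; elim: l => [|i l IH].
  have -> : (fun y => \sum_(i <- [::]) f i y *: T i y) = (fun y => 0 *: S y) :> sect E.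
    by apply: eq_sect => y; rewrite big_nil scale0r.
  rewrite (@ext_diffZ (fun=> 0)) ?mul0r ?big_nil //; exact: msmooth_cst.
have -> : (fun y => \sum_(i <- i :: l) f i y *: T i y) =
    (fun y => f i y *: T i y + \sum_(i <- l) f i y *: T i y) :> sect E.
  by apply: eq_sect => y; rewrite big_cons.
rewrite ext_diffD // ?IH ?big_cons ?ext_diffZ //.
  exact: smooth_sectZ.
by apply: smooth_sect_sum => // j; exact: smooth_sectZ.
Qed.

(** A section T vanishing on V equals (1 - phi) T for a bump function phi with
    phi x = 1 supported in V, and the coefficient 1 - phi vanishes at x. *)
Lemma ext_diff_local S T x V : smooth_sect S -> smooth_sect T ->
  mopen V -> V x -> (forall y, V y -> T y = 0) ->
  ext_diff mu [:: S; T] x = 0.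
Proof.
move=> sS sT oV Vx T0; have cx : car M x by case: oV => + _; apply.
have [phi [W [sphi [oW Wx] W1 off far]]] := mfd_bump hM oV Vx.
pose g y := 1 + (-1 : R) *: phi y.
have -> : T = (fun y => g y *: T y).
  apply: eq_sect => y; have [Vy|nVy] := pselect (V y).
    by rewrite T0 // scaler0.
  by rewrite /g off // scaler0 addr0 scale1r.
rewrite ext_diffZ //; first by rewrite /g W1 // scaleN1r subrr mul0r.
apply: msmoothD (mopen_car hM) (msmooth_cst _ _) _.
exact: msmoothZ (mopen_car hM) (msmooth_cst _ _) sphi.
Qed.

Lemma mopen_common (I : eqType) (l : seq I) (V : I -> set (pt M)) x : car M x ->
  (forall i, mopen (V i) /\ V i x) ->
  exists W, [/\ mopen W, W x & forall i y, i \in l -> W y -> V i y].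
Proof.
move=> cx hV'; elim: l => [|i l [W [oW Wx WV]]].
  by exists (car M); split => //; exact: mopen_car.
have [oV Vx] := hV' i; exists (V i `&` W); split => //; first exact: mopenI.
by move=> j y; rewrite inE => /orP[/eqP->|jl] [Vy Wy] //; exact: WV.
Qed.

(** Near x, T is the combination of a global extension of a local basis with
    coefficients that vanish at x; the remainder vanishes near x, so that
    locality applies to it. *)
Lemma ext_diff_eq0 S T x : smooth_sect S -> smooth_sect T -> car M x ->
  T x = 0 -> ext_diff mu [:: S; T] x = 0.
Proof.
move=> sS sT cx T0; pose t := tat E x.
have tx : tdom t x := tat_dom hV cx.
have ot : mopen (tdom t) := mopen_tdom hV t.
have [e he] := choice (fun a : 'I_r => local_frame hM hV (delta_mx 0 a) tx).
have sc a : msmooth (tdom t) (fun y => tcrd t (T y) 0 a).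
  exact: (msmooth_linear (L := @entry R r a) (@entry_cont R r a) ot (sT.2 t)).
have [g hg] := choice (fun a => extend_fun hM ot tx (sc a)).
have [V hgV] := choice hg.
pose T1 : sect E := fun y => \sum_a g a y *: e a y.
have sg a : msmooth (car M) (g a) by have [] := hgV a.
have se a : smooth_sect (e a) by have [] := he a.
have sT1 : smooth_sect T1.
  by apply: smooth_sect_sum => // a; exact: smooth_sectZ.
have gx a : g a x = 0.
  have [_ _ Vx ->] := hgV a => //.
  by rewrite T0 (tcrd0 hV tx) mxE.
have -> : T = (fun y => (T y - T1 y) + T1 y).
  by apply: eq_sect => y; rewrite subrK.
have sB : smooth_sect (fun y => T y - T1 y) by exact: smooth_sectB.
rewrite ext_diffD // ext_diff_sum // big1 ?addr0; last first.
  by move=> a _; rewrite gx mul0r.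
have [W [oW Wx WT]] : exists W, [/\ mopen W, W x & forall y, W y -> T y = T1 y].
  have [U hU] := choice (fun a => (he a).2).
  have hVx a : mopen (V a `&` U a) /\ (V a `&` U a) x.
    have [_ oV Vx _] := hgV a.
    by have [oU Ux _] := hU a; split => //; exact: mopenI.
  have [W [oW Wx WVU]] := mopen_common (enum 'I_r) cx hVx.
  exists (W `&` tdom t); split => //; first exact: mopenI.
  move=> y [Wy ty].
  rewrite /T1 -{1}(tcrdK hV ty (sT.1 _ (tdom_car hV ty))) (tinv_sum hV) //.
  apply: eq_bigr => a _.
  have [Vy Uy] := WVU a y (mem_enum _ a) Wy.
  have [_ _ _ ->] := hgV a => //.
  by have [_ _ ->] := hU a.
by apply: (ext_diff_local sS sB oW Wx) => y Wy; rewrite WT // subrr.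
Qed.

Lemma ext_diff_tensorialr S T T' x : smooth_sect S -> smooth_sect T ->
  smooth_sect T' -> car M x -> T x = T' x ->
  ext_diff mu [:: S; T] x = ext_diff mu [:: S; T'] x.
Proof.
move=> sS sT sT' cx e.
have sB := smooth_sectB hM hV sT sT'.
have -> : T = (fun y => (T y - T' y) + T' y) by apply: eq_sect => y; rewrite subrK.
by rewrite ext_diffD // ext_diff_eq0 ?add0r // e subrr.
Qed.

Lemma ext_diff_tensorial S S' T T' x : smooth_sect S -> smooth_sect S' ->
  smooth_sect T -> smooth_sect T' -> car M x -> S x = S' x -> T x = T' x ->
  ext_diff mu [:: S; T] x = ext_diff mu [:: S'; T'] x.
Proof.
move=> sS sS' sT sT' cx eS eT.
rewrite (ext_diff_tensorialr sS sT sT' cx eT) ext_diffC //.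
by rewrite (ext_diff_tensorialr sT' sS sS' cx eS) -ext_diffC.
Qed.

(** The two-form d mu as a function of vectors.  It is defined by extending the
    vectors to sections; tensoriality makes the chosen value the only possible
    one. *)
Definition ext_diff_form : Defs.form E := fun x l =>
  get [set c : R | exists S T : sect E, [/\ smooth_sect S, smooth_sect T,
         l = [:: S x; T x] & c = ext_diff mu [:: S; T] x]].

Lemma ext_diff_formE S T x : smooth_sect S -> smooth_sect T -> car M x ->
  ext_diff_form [:: S x; T x] = ext_diff mu [:: S; T] x.
Proof.
move=> sS sT cx; rewrite /ext_diff_form.
case: xgetP => [c _ [S' [T' [sS' sT' [eS eT] ->]]]|]; first exact: ext_diff_tensorial.
by move=> /(_ (ext_diff mu [:: S; T] x)) []; exists S, T.
Qed.

Lemma ext_diff_form_correct : is_ext_diff 1 mu ext_diff_form.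
Proof.
move=> [//|S [//|T [|//]]] x _ ss cx /=.
apply: ext_diff_formE => //; [exact: ss 0%N isT|exact: ss 1%N isT].
Qed.

End Ext.

Section Legendrian.
Context {R : realType} {m n r r' : nat} {N : mfd R m} {M : mfd R n}.
Context {F : algd N r} {A : algd M r'}.
Variables (i : pt N -> pt M) (j : forall x, fib F x -> fib A (i x)).
Variable mu : Defs.form A.
Hypothesis hA : is_lie_algebroid A.
Hypothesis fmu : is_form 1 mu.
Hypothesis hF : lie_subalgebroid j.
Hypothesis mu0 : forall x (u : fib F x), car N x -> fmem u -> mu [:: j u] = 0.

(** If mu pulls back to 0 along a Lie algebroid morphism, then so does d mu, for
    the pullback commutes with the differentials; d mu is thus 0 on the image.
    For a Legendrian subalgebroid this says that it is isotropic for d eta. *)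
Lemma ext_diff_isotropic x (u v : fib F x) (S T : sect A) : car N x -> fmem u -> fmem v ->
  smooth_sect S -> smooth_sect T -> S (i x) = j u -> T (i x) = j v ->
  ext_diff mu [:: S; T] (i x) = 0.
Proof.
move=> cx mu' mv sS sT eS eT.
case: hF => hlF [[vbj morph] _].
have ci : car M (i x) by case: vbj => -[+ _] _; exact.
have hN := hlF.1; have hVF := hlF.2.1.
have [s [ss es]] := sect_through hN hVF cx mu'.
have [t [st et]] := sect_through hN hVF cx mv.
have := morph 1%N mu (ext_diff_form mu) fmu (ext_diff_form_correct hA fmu).
move=> /(_ [:: s; t] x erefl) /= h.
rewrite -(ext_diff_formE hA fmu) // eS eT -es -et [LHS]h //; last by move=> [|[]].
rewrite ext_diff2 /pullback /=.
have [mb _] := smooth_bracket hlF ss st.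
rewrite !(@der_cst_near _ _ _ hN x _ _ 0 (car N) (mopen_car hN)) //.
- by rewrite mu0 ?subrr //; exact: mb.
- by move=> y cy; rewrite mu0 //; exact: ss.1.
- by move=> y cy; rewrite mu0 //; exact: st.1.
Qed.

End Legendrian.

(** * Contact form of the prolongation *)

Section Chain.
Context {R : realType} {n : nat} {M : mfd R n}.
Hypothesis hM : is_manifold M.

(** Components of a tangent vector in any chart compute derivatives in that
    chart, although der is defined with the preferred chart at_ x. *)
Lemma der_tvec i x w (f : pt M -> R) : msmooth (car M) f -> dom i x ->
  der x (tvec i x w) f = 'd (f \o bwd i) (fwd i x) w.
Proof.
move=> sf dx; have cx := dom_car hM dx; have ax := at_dom hM cx.
have dt : differentiable (fwd (at_ x) \o bwd i) (fwd i x).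
  by apply: smooth_diff (smooth_transition hM i (at_ x)) _; exists x.
have df := der_diff hM sf cx.
have e : (fwd (at_ x) \o bwd i) (fwd i x) = fwd (at_ x) x by rewrite /= bwdK.
have nc := near_chart hM (mopen_dom hM (at_ x)) ax dx.
have dc : differentiable (f \o bwd (at_ x)) ((fwd (at_ x) \o bwd i) (fwd i x)).
  by rewrite e.
have [] := @near_eq_diff R _ _ ((f \o bwd (at_ x)) \o (fwd (at_ x) \o bwd i))
   (f \o bwd i) (fwd i x) _ (differentiable_comp dt dc).
  by apply: filterS nc => z [az _ _] /=; rewrite (bwdK hM az).
by move=> _ ->; have -> := diff_comp dt dc; rewrite e.
Qed.

(** In particular a function that vanishes on the image of f has derivative 0
    along every vector T f (v). *)
Lemma der_tmap (m : nat) (N : mfd R m) (f : pt N -> pt M) (g : pt M -> R) x v :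
  is_manifold N -> smooth_map f -> car N x -> msmooth (car M) g ->
  der (f x) (tmap f x v) g = der x v (g \o f).
Proof.
move=> hN [fc sf] cx sg; have ax := at_dom hN cx; have afx := at_dom hM (fc _ cx).
have [oD sD] := sf (at_ x) (at_ (f x)).
have Dx : (dom (at_ x) `&` f @^-1` dom (at_ (f x))) x by [].
have dt : differentiable (fwd (at_ (f x)) \o f \o bwd (at_ x)) (fwd (at_ x) x).
  by apply: smooth_diff sD _; exists x.
have e : (fwd (at_ (f x)) \o f \o bwd (at_ x)) (fwd (at_ x) x) = fwd (at_ (f x)) (f x).
  by rewrite /= bwdK.
have nc := near_chart hN oD Dx ax.
have dc : differentiable (g \o bwd (at_ (f x)))
    ((fwd (at_ (f x)) \o f \o bwd (at_ x)) (fwd (at_ x) x)).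
  by rewrite e; apply: der_diff => //; exact: fc.
have [] := @near_eq_diff R _ _
   ((g \o bwd (at_ (f x))) \o (fwd (at_ (f x)) \o f \o bwd (at_ x)))
   (g \o f \o bwd (at_ x)) (fwd (at_ x) x) _ (differentiable_comp dt dc).
  by apply: filterS nc => z [[_ az] _ _] /=; rewrite (bwdK hM az).
by rewrite /der => _ ->; have -> := diff_comp dt dc; rewrite e.
Qed.

Lemma smooth_fwd i : msmooth (dom i) (fwd i : pt M -> 'rV[R]_n).
Proof. by move=> j; exact: smooth_transition. Qed.

End Chain.

Section Prol.
Context {R : realType} {n k : nat} {Q : mfd R n} {E : algd Q k}.
Hypothesis hE : is_lie_algebroid E.
Variable br : sect (prol_vb E) -> sect (prol_vb E) -> sect (prol_vb E).
Hypothesis hbr : is_prolongation_bracket br.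

Notation P := (phase E).
Notation A := (prolongation br).
Notation eta := (@contact_form R n k Q E).

Let hA : is_lie_algebroid A := hbr.1.
Let hP : is_manifold P := hA.1.
Let hV : is_vbundle (prol_vb E) := hA.2.1.

(** The fibre coordinates s and y_a of E^* x R are linear in the chart
    coordinates, hence equal to their own differentials. *)
Definition coord_s : 'rV[R]_(n + k + 1) -> R := entry 0 \o rsubmx.
Definition coord_y (a : 'I_k) : 'rV[R]_(n + k + 1) -> R :=
  entry a \o (rsubmx \o lsubmx).
HB.instance Definition _ := GRing.Linear.on coord_s.
HB.instance Definition _ a := GRing.Linear.on (coord_y a).

Lemma coord_s_cont : continuous coord_s.
Proof.
move=> z; apply: continuous_comp; last exact: entry_cont.
exact: continuous_rsubmx.
Qed.

Lemma coord_y_cont a : continuous (coord_y a).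
Proof.
move=> z; apply: continuous_comp; last exact: entry_cont.
apply: continuous_comp; first exact: continuous_lsubmx.
exact: continuous_rsubmx.
Qed.

Lemma smooth_fiber_s : msmooth (M := P) (car P) (fun p : pt P => (projT2 p).2).
Proof.
move=> c m; exact: (Cm_of_linear (L := coord_s) m _ coord_s_cont).
Qed.

(** The local expression eta = V^s - y_a X^a of the contact form. *)
Lemma contact_tinv (c : idx P) (p : pt P) z : dom c p ->
  eta [:: prol_tinv c p z] = rsubmx (rsubmx z) 0 0 -
    \sum_a (lsubmx z) 0 a * coord_y a (fwd c p).
Proof.
move=> dp.
have cp : car P p := dom_car hP dp.
have [cq [bl _]] := cp.
rewrite /contact_form.
rewrite (der_tvec hP _ smooth_fiber_s dp).
have -> : 'd ((fun p0 : pt P => (projT2 p0).2) \o bwd c) (fwd c p) = coord_s :> (_ -> _).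
  exact: (diff_lin (f := coord_s) _ coord_s_cont).
rewrite {1}/coord_s /= row_mxKr; congr (_ - _).
have [_ _ tq] : [/\ phase_car p, dom c.1 (projT1 p) & tdom c.2 (projT1 p)] := dp.
have hVE := hE.2.1.
have bZ (u : fib E (projT1 p)) (a : R) : fmem u -> (projT2 p).1 (a *: u) = a * (projT2 p).1 u.
  move=> mu; have m0 := fmem0 hVE cq.
  have b0 : (projT2 p).1 0 = 0.
    by have := bl (-1) 0 0 m0 m0; rewrite scaler0 addr0 mulN1r addNr.
  by rewrite -[_ *: u]addr0 bl // b0 addr0.
rewrite (tinv_sum hVE (x := projT1 p) _ tq).
have bS (l : seq 'I_k) (f : 'I_k -> fib E (projT1 p)) : (forall a, fmem (f a)) ->
    fmem (\sum_(a <- l) f a) /\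
    (projT2 p).1 (\sum_(a <- l) f a) = \sum_(a <- l) (projT2 p).1 (f a).
  move=> mf; have m0 := fmem0 hVE cq.
  elim: l => [|a l [IH1 IH2]].
    by rewrite !big_nil; split => //; rewrite -(scale0r 0) bZ // mul0r.
  rewrite !big_cons; split; first exact: fmemD.
  by rewrite -[f a]scale1r bl // IH2 mul1r scale1r.
have mt a : fmem (tinv c.2 (projT1 p) (delta_mx 0 a)) := tinv_mem hVE _ tq.
rewrite (bS _ _ _).2; last by move=> a; exact: fmemZ.
apply: eq_bigr => a _; rewrite bZ // /coord_y /entry /=; congr (_ * _).
by rewrite /phase_fwd row_mxKl row_mxKr mxE.
Qed.

Lemma contact_is_form : is_form (E := prol_vb E) 1 eta.
Proof.
split=> [p [|? s1] [|? s2] a u v cp //= _ mw|]; last split.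
- have [cq [bl _]] := cp.
  rewrite /contact_form der_lin bl; first by ring.
    have [] // : fmem u by apply: mw; rewrite !inE eqxx.
  have [] // : fmem v by apply: mw; rewrite !inE eqxx orbT.
- by move=> p [|? ?] [|? ?] [|? ?].
- move=> c [|z [|]] //= _.
  have oc := mopen_dom hP c.
  apply: (msmooth_ext hP (f := fun p => rsubmx (rsubmx z) 0 0 + (-1 : R) *:
    (\sum_a (lsubmx z) 0 a *: (coord_y a (fwd c p) : R) : R)) oc).
    by move=> p dp; rewrite scaleN1r; symmetry; exact: contact_tinv.
  apply: (msmoothD oc (msmooth_cst _ _)).
  apply: (msmoothZ oc (msmooth_cst _ _)).
  apply: (msmooth_sum _ oc) => a; apply: (msmoothZ oc (msmooth_cst _ _)).
  exact: (msmooth_linear (L := coord_y a) (@coord_y_cont a) oc (@smooth_fwd _ _ P hP c)).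
Qed.

(** The bracket of V_a with any element e of the basis is 0, and eta (V_a) = 0
    near p, so that only the derivative of eta (e) along the y_a direction is
    left; as eta = V^s - y_a X^a, this gives d eta (V_a, .) = -X^a. *)
Lemma ext_diff_frame (c : idx P) (p : pt P) (a : 'I_k) (l : 'I_(k + (k + 1)))
    (S T : sect (prol_vb E)) : dom c p -> smooth_sect S -> smooth_sect T ->
  Defs.eq_near p S (prol_basis c (rshift k (lshift 1 a))) ->
  Defs.eq_near p T (prol_basis c l) ->
  ext_diff (E := A) eta [:: S; T] p = - (l == lshift (k + 1) a)%:R.
Proof.
move=> dp sS sT nS nT; have cp : car P p := dom_car hP dp.
have oc := mopen_dom hP c.
have b0 : br S T p = 0.
  have [_ h] := hbr; have [_ h2] := h c p S T dp sS sT.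
  by apply: (h2 _ _ _ nS nT); rewrite /= leq_addr.
have etaE l' U' : Defs.eq_near p U' (prol_basis c l') -> exists W, [/\ mopen W, W p &
    forall y, W y -> U' y = prol_basis c l' y /\
      eta [:: U' y] = (l' == rshift k (rshift k 0))%:R -
       \sum_b (l' == lshift (k + 1) b)%:R * coord_y b (fwd c y)].
  move=> [W [oW Wp WU]]; exists (W `&` dom c); split=> //.
    exact: mopenI.
  move=> y [Wy dy]; rewrite WU //; split=> //; rewrite /prol_basis contact_tinv //.
  rewrite !mxE eqxx /= eq_sym; congr (_ - _); apply: eq_bigr => b _.
  by rewrite !mxE eqxx /= eq_sym.
have [WS [oS WSp hS]] := etaE _ _ nS; have [WT [oT WTp hT]] := etaE _ _ nT.
have t2 v : der p v (fun y => eta [:: S y]) = 0.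
  apply: (der_cst_near hP v (c := 0) oS WSp) => y /hS[_ ->].
  rewrite !eq_shift /= sub0r big1 ?oppr0 // => b _.
  by rewrite eq_shift mul0r.
have t3 : eta [:: bracket (S : sect A) (T : sect A) p] = 0.
  by rewrite [bracket _ _ _]b0 (form10 hV contact_is_form).
rewrite ext_diff2 t2 t3 !subr0.
have [eSp _] := hS p WSp.
case: (split_ordP l) hT => b -> hT; last first.
  rewrite eq_shift oppr0.
  apply: (der_cst_near hP _ (c := (rshift k b == rshift k (rshift k 0))%:R) oT WTp).
  move=> y /hT[_ ->]; rewrite big1 ?subr0 // => i _.
  by rewrite eq_shift mul0r.
have -> : anchor (S p : fib A p) = (S p).2 by [].
rewrite eSp /prol_basis /prol_tinv /=.
have sm := smooth_form1 hP hV contact_is_form sT.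
rewrite der_tvec //.
set w := row_mx _ _.
have nc := near_chart hP oT WTp dp.
have dy : differentiable (coord_y b) (fwd c p).
  exact: (linear_differentiable (f := coord_y b) (fwd c p) (@coord_y_cont b)).
have [] := @near_eq_diff R _ _ (- (coord_y b : _ -> R))
   ((fun y => eta [:: T y]) \o bwd c) (fwd c p)
   _ (differentiableN dy).
  apply: filterS nc => z [/hT[_ Tz] _ ez].
  rewrite [RHS]Tz eq_shift sub0r (bigD1 b) //= eqxx mul1r big1 ?addr0 => [|i ib].
    by rewrite (ez : phase_fwd c (phase_bwd c z) = z).
  by rewrite (inj_eq (@lshift_inj _ _)) eq_sym (negbTE ib) mul0r.
move=> _ ->; rewrite diffN // (diff_lin (f := coord_y b) _ (@coord_y_cont b)).
transitivity (- coord_y b w); first by [].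
congr (- _); rewrite /coord_y /= /entry /w row_mxKl row_mxKr !mxE eqxx /=.
by rewrite !(inj_eq (@lshift_inj _ _), inj_eq (@rshift_inj _ _)).
Qed.

End Prol.

(** * Vertical vectors and the Hamilton-Jacobi theorem *)

Section Vertical.
Context {R : realType} {n k : nat} {Q : mfd R n} {E : algd Q k}.
Hypothesis hE : is_lie_algebroid E.
Variable br : sect (prol_vb E) -> sect (prol_vb E) -> sect (prol_vb E).
Hypothesis hbr : is_prolongation_bracket br.

Notation P := (phase E).
Notation A := (prolongation br).
Notation eta := (@contact_form R n k Q E).

Let hA : is_lie_algebroid A := hbr.1.
Let hP : is_manifold P := hA.1.
Let hV : is_vbundle (prol_vb E) := hA.2.1.
Let feta : is_form (E := prol_vb E) 1 eta := contact_is_form hE hbr.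

(** A vertical vector killed by eta is a combination z^a V_a.  Since
    d eta (V_a, .) = -X^a only sees the component in E, pairing it by d eta with
    any vectors that project to the basis of E recovers each z^a. *)
Lemma vertical_deta_orthogonal_eq0 (c : idx P) (p : pt P) (S : sect (prol_vb E)) :
  dom c p -> smooth_sect S -> (S p).1 = 0 -> eta [:: S p] = 0 ->
  (forall b : 'I_k, exists T : sect (prol_vb E), [/\ smooth_sect T,
     tcrd c.2 (T p).1 = delta_mx 0 b & ext_diff (E := A) eta [:: T; S] p = 0]) ->
  S p = 0.
Proof.
move=> dp sS S1 etaS hT; have cp : car P p := dom_car hP dp.
have [_ _ tq] : [/\ phase_car p, dom c.1 (projT1 p) & tdom c.2 (projT1 p)] := dp.
pose z : 'rV[R]_(k + (k + 1)) := tcrd (v := prol_vb E) c (S p).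
have Sz : tinv (v := prol_vb E) c p z = S p.
  by apply: (tcrdK hV) => //; exact: sS.1.
have zx : lsubmx z = 0.
  by rewrite /z /= /prol_tcrd row_mxKl S1 (tcrd0 hE.2.1 tq).
clearbody z.
have zs : z 0 (rshift k (rshift k 0)) = 0.
  move: etaS; rewrite -Sz [LHS](contact_tinv hE hbr z dp) zx.
  rewrite big1 ?subr0; last by move=> a _; rewrite mxE mul0r.
  by rewrite !mxE.
have [e he] := choice (fun l : 'I_(k + (k + 1)) =>
  local_frame hP hV (t := c) (delta_mx 0 l) dp).
have se l : smooth_sect (e l) by have [] := he l.
have ne l : Defs.eq_near p (e l) (prol_basis c l) by have [] := he l.
have ep l : e l p = tinv (v := prol_vb E) c p (delta_mx 0 l).
  by have [_ [W [_ Wp ->]]] := he l.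
pose comb (v : 'rV[R]_(k + (k + 1))) : sect (prol_vb E) :=
  fun y => \sum_l v 0 l *: e l y.
have scst a : msmooth (car P) (fun=> a : R) by exact: msmooth_cst.
have scomb v : smooth_sect (comb v).
  by apply: smooth_sect_sum => // l; exact: (smooth_sectZ hP hV (scst _)).
have combp v : comb v p = tinv (v := prol_vb E) c p v.
  by rewrite (tinv_sum hV _ (t := c)) //; apply: eq_bigr => l _; rewrite ep.
have ext_comb (T : sect A) v : smooth_sect T ->
    ext_diff (E := A) eta [:: T; comb v] p =
    \sum_l v 0 l * ext_diff (E := A) eta [:: T; e l] p.
  by move=> sT; exact: (ext_diff_sum hA feta (index_enum _)
     (f := fun l _ => v 0 l) sT se (fun l => scst _) cp).
have zy b : z 0 (rshift k (lshift 1 b)) = 0.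
  have [T [sT Tb]] := hT b.
  rewrite (ext_diff_tensorialr hA feta sT sS (scomb z) cp); last by rewrite combp.
  rewrite ext_comb // !big_split_ord /= big_ord1 zs mul0r addr0.
  rewrite big1 ?add0r; last first.
    by move=> a _; have /rowP/(_ a) := zx; rewrite !mxE => ->; rewrite mul0r.
  pose z' : 'rV[R]_(k + (k + 1)) := tcrd (v := prol_vb E) c (T p).
  have Tz' : T p = comb z' p.
    rewrite combp; symmetry; apply: (tcrdK hV) => //; exact: sT.1.
  have extT a : ext_diff (E := A) eta [:: T; e (rshift k (lshift 1 a))] p = (a == b)%:R.
    rewrite (ext_diffC hA feta) //.
    rewrite (ext_diff_tensorialr hA feta (se _) sT (scomb z') cp) // ext_comb //.
    have fr l := ext_diff_frame hE hbr dp (se (rshift k (lshift 1 a))) (se l) (ne _) (ne l).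
    rewrite (bigD1 (lshift (k + 1) a)) //= big1 ?addr0.
      rewrite fr eqxx mulrN1 opprK.
      have -> : z' 0 (lshift (k + 1) a) = tcrd c.2 (T p).1 0 a by exact: row_mxEl.
      by rewrite Tb mxE eqxx.
    by move=> l nl; rewrite fr (negbTE nl) oppr0 mulr0.
  rewrite (bigD1 b) //= extT eqxx mulr1 big1 ?addr0 //.
  by move=> a nab; rewrite extT (negbTE nab) mulr0.
have z0 : z = 0.
  apply/rowP => l; rewrite mxE; case: (split_ordP l) => a ->.
    by have /rowP/(_ a) := zx; rewrite !mxE.
  case: (split_ordP a) => b ->; first exact: zy.
  by rewrite ord1.
by rewrite -Sz z0 (tinv0 hV dp).
Qed.

End Vertical.

Theorem theorem7p3 (R : realType) (n k : nat) (Q : mfd R n) (E : algd Q k)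
  (hE : is_lie_algebroid E)
  (br : sect (prol_vb E) -> sect (prol_vb E) -> sect (prol_vb E))
  (hbr : is_prolongation_bracket br)
  (Rb : sect (prol_vb E))
  (hRb : is_reeb (E := prolongation br) (@contact_form R n k Q E) Rb)
  (H : pt (phase E) -> R) (hH : msmooth (M := phase E) (car (phase E)) H)
  (xi : sect (prol_vb E))
  (hxi : is_hamiltonian_section (E := prolongation br)
           (@contact_form R n k Q E) Rb H xi)
  (gamma : forall q : pt Q, ((fib E q -> R) * R)%type)
  (hgamma : smooth_map (M := Q) (N := phase E) (sec_map gamma))
  (hleg : legendrian (F := F_gamma gamma) (A := prolongation br)
            (j_gamma (gamma := gamma)) (@contact_form R n k Q E)) :
  gamma_related gamma xi (xi_gamma gamma xi) <->
  (forall q : pt Q, car Q q -> H (sec_map gamma q) = 0).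
Proof.
have hQ := hE.1; have hVE := hE.2.1.
have hA := hbr.1; have hP : is_manifold (phase E) := hA.1.
have hV : is_vbundle (prol_vb E) := hA.2.1.
have feta := contact_is_form hE hbr.
have [sxi [etaxi dxi]] := hxi.
have [hsub [_ eta0]] := hleg.
have carp q : car Q q -> car (phase E) (sec_map gamma q) by case: hgamma => + _; apply.
have carF q : car Q q -> car (gamma_image gamma) (sec_map gamma q) by move=> cq; exists q.
have memF q (a : fib E q) : car Q q -> fmem a ->
    fmem (gamma_lift gamma a : fib (F_gamma gamma) (sec_map gamma q)).
  by move=> cq ma; exists a.
have eta_lift q (a : fib E q) : car Q q -> fmem a ->
    contact_form [:: gamma_lift gamma a] = 0.
  by move=> cq ma; apply: eta0 (carF q cq) (memF q a cq ma).
have xi1 q : car Q q -> fmem (xi_gamma gamma xi q).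
  by move=> cq; have [] := sxi.1 _ (carp q cq).
split=> [rel q cq|H0 q cq].
  have := etaxi _ (carp q cq); rewrite (rel q cq) eta_lift //; last exact: xi1.
  by move=> /esym/eqP; rewrite oppr_eq0 => /eqP.
set p := sec_map gamma q; have cp : car (phase E) p := carp q cq.
have mlift (a : fib E q) : fmem a -> fmem (gamma_lift gamma a : fib (prol_vb E) p).
  move=> ma; case: hsub => _ [[[_ [h _]] _] _].
  exact: (h p _ (carF q cq) (memF q a cq ma)).
(* xi p - S0 p is the vertical defect: it has component 0 in E. *)
have [S0 [sS0 S0p]] := sect_through hP hV cp (mlift _ (xi1 q cq)).
pose c := at_ p; have dp : dom c p := at_dom hP cp.
have tq : tdom c.2 q by case: dp.
suff D0 : xi p - S0 p = 0 by apply/eqP; rewrite -subr_eq0 -S0p D0.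
have sB := smooth_sectB hP hV sxi sS0.
apply: (vertical_deta_orthogonal_eq0 hE hbr (S := fun y => xi y - S0 y) dp sB).
- by rewrite S0p /= subrr.
- cbv beta; rewrite -scaleN1r addrC (form1_lin feta) //; [|exact: sS0.1|exact: sxi.1].
  by rewrite S0p eta_lift ?etaxi ?H0 ?mulr0 ?oppr0 ?addr0 //; exact: xi1.
move=> b.
have mb : fmem (tinv c.2 q (delta_mx 0 b)) := tinv_mem hVE _ tq.
have [T [sT Tp]] := sect_through hP hV cp (mlift _ mb).
exists T; split=> //; first by rewrite Tp /= (tinvK hVE tq).
(* In the equation for xi the right-hand side d H (T) - Rb(H) eta(T) vanishes
   at p: eta is 0 on F_gamma, and the anchor of T at p is tangent to gamma(Q),
   where H is 0. *)
have extxi : ext_diff (E := prolongation br) (@contact_form R n k Q E) [:: xi; T] p = 0.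
  rewrite dxi // Tp eta_lift // mulr0 subr0.
  rewrite /ext_diff /= big_ord1 big_ord1 /= big_mkcond big_ord1 /= addr0 mul1r Tp.
  rewrite (der_tmap hP _ hQ hgamma cq hH).
  by apply: (der_cst_near hQ _ (mopen_car hQ) cq (c := 0)).
have ext0 : ext_diff (E := prolongation br) (@contact_form R n k Q E) [:: S0; T] p = 0.
  exact: (ext_diff_isotropic hA feta hsub eta0 (carF q cq) (memF _ _ cq (xi1 q cq))
    (memF _ _ cq mb) sS0 sT S0p Tp).
have sN : smooth_sect (fun y => (-1) *: S0 y).
  by apply: (smooth_sectZ hP hV) => //; exact: msmooth_cst.
have -> : (fun y => xi y - S0 y) = (fun y => xi y + (-1) *: S0 y) :> sect (prol_vb E).
  by apply: eq_sect => y; rewrite scaleN1r.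
rewrite (ext_diffD hA feta sT sxi sN cp).
rewrite (ext_diffZ hA feta (f := fun=> -1) _ sT sS0 cp); last exact: msmooth_cst.
rewrite (ext_diffC hA feta sT sxi cp) (ext_diffC hA feta sT sS0 cp) extxi ext0.
by rewrite oppr0 mulr0 addr0.
Qed.
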